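(* Let $d\ge4$. (i) There is $q_0>1$ such that for all $p\in[0,1]$ and $q\in[1,q_0)$ there is a unique Gibbs measure for the random conductance model with parameters $p,q$. (ii) For every $q\ge1$ there is $p_0=p_0(q,d)>0$ such that for all $p\in[0,p_0)\cup(1-p_0,1]$ there is a unique Gibbs measure for the random conductance model with parameters $p,q$.
   Context: For a finite connected (multi)graph $H$ with conductances $c$, $\Delta^H_cf(x)=\sum_{e=\{x,y\}}c_e(f(x)-f(y))$ on zero-sum functions on $\mathbf V(H)$, determinant $\det\Delta^H_c$. $h(\kappa,E'),s(\kappa,E')$ count $e\in E'$ with $\kappa_e=q$, resp. $\kappa_e=1$. $\Lambda_N=[-N,N]^d\cap\mathbb Z^d$, $E_N$ its internal nearest-neighbour edges. For finite $E\subset E_N$ and $\kappa,\lambda\in\{1,q\}^{\mathbf E(\mathbb Z^d)}$: $\bar\gamma^{\Lambda_N}_E(\kappa,\lambda)=\mathbb 1_{\kappa_{E^c}=\lambda_{E^c}}w(\kappa)/\sum_{\sigma:\sigma_{E^c}=\lambda_{E^c}}w(\sigma)$, $w(\sigma)=p^{h(\sigma,E_N)}(1-p)^{s(\sigma,E_N)}(\det\Delta^{\Lambda_N}_\sigma)^{-1/2}$ (with $0^0=1$), and $\bar\gamma_E(\kappa,\lambda)=\lim_N\bar\gamma^{\Lambda_N}_E(\kappa,\lambda)$ (the limit exists). A probability measure $\bar\mu$ on $\{1,q\}^{\mathbf E(\mathbb Z^d)}$ (product $\sigma$-algebra) is a Gibbs measure for the random conductance model if $\int\bar\gamma_E(A,\lambda)\bar\mu(d\lambda)=\bar\mu(A)$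 for all finite $E$ and measurable $A$, with $\bar\gamma_E(A,\lambda)=\sum_{\kappa\in A,\kappa_{E^c}=\lambda_{E^c}}\bar\gamma_E(\kappa,\lambda)$. *)

(* Defs.v *)
From HB Require Import structures.
From mathcomp Require Import all_boot all_order all_algebra finmap.
From mathcomp Require Import all_classical all_reals all_analysis.
Set Implicit Arguments. Unset Strict Implicit. Unset Printing Implicit Defensive.
Import Order.TTheory GRing.Theory Num.Theory.
Import numFieldNormedType.Exports.
Local Open Scope ring_scope.
Local Open Scope classical_set_scope.

Section RCM.
Variable d : nat.

Definition site := {ffun 'I_d -> int}.

Definition shift (x : site) (i : 'I_d) : site :=
  [ffun j => if j == i then x j + 1 else x j].

(** Nearest-neighbour edges of Z^d: the pair (x, i) stands for the
    (unordered) edge {x, x + e_i}; this is a bijection with E(Z^d). *)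
Definition edge := (site * 'I_d)%type.

(** Configurations kappa in {1,q}^{E(Z^d)}: [k e = true] means kappa_e = q,
    [k e = false] means kappa_e = 1. *)
Definition cfg := edge -> bool.

Definition cond (R : numDomainType) (q : R) (k : cfg) (e : edge) : R :=
  if k e then q else 1.

Definition box (N : nat) := {ffun 'I_d -> 'I_(2 * N + 1)}.
Definition emb (N : nat) (v : box N) : site := [ffun j => (v j)%:Z - N%:Z].
Definition in_box (N : nat) (x : site) : bool :=
  [forall j, (- (N%:Z) <= x j) && (x j <= N%:Z)].

Definition adj (R : numDomainType) (q : R) (k : cfg) (N : nat) (v w : box N) : R :=
  \sum_(i < d)
     ((if emb w == shift (emb v) i then cond q k (emb v, i) else 0)
    + (if emb v == shift (emb w) i then cond q k (emb w, i) else 0)).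

Definition lap (R : realType) (q : R) (k : cfg) (N : nat)
    (f : {ffun box N -> R^o}) : {ffun box N -> R^o} :=
  [ffun v => \sum_(w : box N) adj q k v w * (f v - f w)].

Definition sumf (R : realType) (N : nat) : 'Hom({ffun box N -> R^o}, R^o) :=
  linfun (fun f : {ffun box N -> R^o} => \sum_v f v).
Definition zerosum (R : realType) (N : nat) := lker (sumf R N).

(** Delta restricted to (the invariant subspace of) zero-sum functions. *)
Definition lap0 (R : realType) (q : R) (k : cfg) (N : nat)
    : 'End(subvs_of (zerosum R N)) :=
  linfun (fun u : subvs_of (zerosum R N) =>
            vsproj (zerosum R N) (lap q k (vsval u))).

Definition detLap (R : realType) (q : R) (k : cfg) (N : nat) : R :=
  \det (passmx.mxof (vbasis fullv) (vbasis fullv) (lap0 q k N)).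

Definition nhigh (N : nat) (k : cfg) : nat :=
  #|[set vi : box N * 'I_d | in_box N (shift (emb vi.1) vi.2) && k (emb vi.1, vi.2)]|.
Definition nlow (N : nat) (k : cfg) : nat :=
  #|[set vi : box N * 'I_d | in_box N (shift (emb vi.1) vi.2) && ~~ k (emb vi.1, vi.2)]|.

(** w(sigma) = p^h (1-p)^s (det Delta)^{-1/2}  (nat powers: 0^0 = 1). *)
Definition weight (R : realType) (p q : R) (N : nat) (k : cfg) : R :=
  p ^+ nhigh N k * (1 - p) ^+ nlow N k * (Num.sqrt (detLap q k N))^-1.

Definition upd (l : cfg) (E : {fset edge}) (t : {ffun E -> bool}) : cfg :=
  fun e => if (insub e : option E) is Some e' then t e' else l e.

Definition agree_off (E : {fset edge}) (k l : cfg) : Prop :=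
  forall e, e \notin E -> k e = l e.

Definition gammaN (R : realType) (p q : R) (N : nat) (E : {fset edge})
    (k l : cfg) : R :=
  (if `[< agree_off E k l >] then 1 else 0) * weight p q N k
  / \sum_(t : {ffun E -> bool}) weight p q N (upd l t).

Definition gamma (R : realType) (p q : R) (E : {fset edge}) (k l : cfg) : R :=
  limn (fun N => gammaN p q N E k l).

Definition gammaA (R : realType) (p q : R) (E : {fset edge}) (A : set cfg)
    (l : cfg) : R :=
  \sum_(t : {ffun E -> bool})
     (if `[< A (upd l t) >] then 1 else 0) * gamma p q E (upd l t) l.

Definition cylinders : set (set cfg) :=
  fun A => exists (e : edge) (b : bool), A = [set k | k e = b].
Definition Omega := g_sigma_algebraType cylinders.

Definition gibbs (R : realType) (p q : R) (mu : probability Omega R) : Prop :=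
  forall (E : {fset edge}) (A : set Omega), measurable A ->
    (\int[mu]_l (gammaA p q E A l)%:E = mu A)%E.

Definition unique_gibbs (R : realType) (p q : R) : Prop :=
  exists mu : probability Omega R, gibbs p q mu /\
    forall nu : probability Omega R, gibbs p q nu ->
      forall A : set Omega, measurable A -> nu A = mu A.

End RCM.

(* Main.v *)
From HB Require Import structures.
From mathcomp Require Import all_boot all_order all_algebra finmap.
From mathcomp Require Import all_classical all_reals all_analysis.
From mathcomp Require Import measurable_realfun.
From mathcomp Require Import ring lra zify.
Require Import Defs.
Set Implicit Arguments. Unset Strict Implicit. Unset Printing Implicit Defensive.
Import Order.TTheory GRing.Theory Num.Theory.
Import numFieldNormedType.Exports.
Local Open Scope classical_set_scope.
Local Open Scope ring_scope.

(** Flipping an edge [e] multiplies the determinant by [1 + (q - 1) R_e], where [R_e] is the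
    effective resistance of [e] in the configuration with [e] low.  By Rayleigh monotonicity
    [R_e] decreases in the configuration and in the box, so the infinite-volume specification
    exists and is monotone.  Couple monotonically the laws in a box with all-low and all-high
    boundary conditions.  A discrepancy at [f] changes [R_e] by at most a multiple of the
    squared gradient at [f] of the potential of a unit dipole at [e]; since gradients of dipole
    potentials are symmetric in [e] and [f], summing over [e] costs only the energy of the
    dipole at [f], which is at most [1].  The discrepancies outside the box cost in total at most
    the difference of Foster's sums for the free and the wired box, a boundary term.  When
    [p (1 - p) (q - 1)^2 q^2 <= 1] the first contribution is absorbed, the expected number of
    discrepancies is of boundary order, and by monotonicity and translation invariance the
    discrepancy probability at a fixed edge tends to [0].  This gives uniqueness; the limit of
    the all-low boundary laws exists and is realised on the unit interval. *)

(** * Gram matrices *)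

(** Weights have no infinite-volume limit, but the ratio of two weights differing at one edge does.
    Every law is therefore encoded by its single-edge conditional odds; box laws, infinite-volume
    kernels, translates and truncations are instances of one recursion [gexp]. The smallness
    condition is a product of three costs. The conditional probability of an edge is Lipschitz in
    its resistance with constant [p * (1 - p) * (q - 1) / 2]; a discrepancy changes a conductance by
    [q - 1]; and [q ^+ 2] is paid because [R_e] is computed with [e] low, in a configuration
    depending on [e], whereas the symmetry of gradients needs one configuration common to all edges.
    The condition says that the product is at most 1/2. A further obstacle is that the
    infinite-volume resistance, a limit of decreasing local functions, is only shown to be
    continuous along configurations approached from below. Passing to the limit in the Gibbs
    equation therefore goes through increasing events and configurations truncated downwards. *)

(** The matrix determinant lemma: one bordered matrix is factored in two ways and the determinants
    are compared. *)
Lemma det_rank1_update (R : comUnitRingType) (n : nat) (A : 'M[R]_n)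
    (u : 'cV[R]_n) (v : 'rV[R]_n) : A \in unitmx ->
  \det (A + u *m v) = \det A * (1 + (v *m invmx A *m u) 0 0).
Proof.
move=> uA.
have h1 : block_mx A (- u) v 1%:M =
    block_mx A 0 v 1%:M *m block_mx 1%:M (- (invmx A *m u)) 0 (1 + (v *m invmx A *m u) 0 0)%:M.
  rewrite mulmx_block !mulmx1 !mulmx0 !mul0mx !addr0 !mul1mx !mulmxN mulKVmx //.
  congr block_mx; rewrite mulmxA.
  by apply/matrixP => i j; rewrite !ord1 !mxE /=; rewrite mulr1n addrC addrK.
have h2 : block_mx A (- u) v 1%:M =
    block_mx 1%:M (- u) 0 1%:M *m block_mx (A + u *m v) 0 v 1%:M.
  by rewrite mulmx_block !mulmx1 !mulmx0 !mul0mx !add0r !mul1mx mulNmx addrK.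
have := congr1 determinant h1; rewrite {1}h2 !det_mulmx !det_ublock !det_lblock !det1.
by rewrite !mul1r !mulr1 det_scalar1.
Qed.

Section Gram.
Variables (R : rcfType) (n : nat) (I : eqType).
Implicit Types (s : seq I) (c : I -> R) (b : I -> 'rV[R]_n) (u v : 'rV[R]_n).

Definition dot u v : R := (u *m v^T) 0 0.

Lemma dotC u v : dot u v = dot v u.
Proof. by rewrite /dot -[u in LHS]trmxK -trmx_mul mxE. Qed.

Lemma dotE u v : dot u v = \sum_j u 0 j * v 0 j.
Proof. by rewrite /dot mxE; apply: eq_bigr => j _; rewrite mxE. Qed.

(** With [b i] the gradient along edge [i] and [c] the conductances, this is the matrix of the
    Dirichlet form in a chosen basis. *)
Definition gram s c b : 'M[R]_n := \sum_(i <- s) c i *: ((b i)^T *m b i).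

Lemma dot_gram s c b u v :
  dot (u *m gram s c b) v = \sum_(i <- s) c i * dot u (b i) * dot v (b i).
Proof.
rewrite /dot /gram mulmx_sumr mulmx_suml summxE; apply: eq_bigr => i _.
rewrite -scalemxAr -scalemxAl mxE -mulrA; congr (_ * _).
have -> : u *m ((b i)^T *m b i) *m v^T = (u *m (b i)^T) *m (b i *m v^T) by rewrite !mulmxA.
by rewrite mxE big_ord_recl big_ord0 addr0 -!/(dot _ _) [dot (b i) v]dotC.
Qed.

Lemma gram_change s c c' b i : uniq s -> i \in s -> (forall j, j != i -> c j = c' j) ->
  gram s c b = gram s c' b + (c i - c' i) *: ((b i)^T *m b i).
Proof.
move=> us si cc'; rewrite /gram !(perm_big _ (perm_to_rem si)) !big_cons addrAC -scalerDl.
rewrite addrCA subrr addr0; congr (_ + _); rewrite !big_seq; apply: eq_bigr => j.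
by rewrite mem_rem_uniq // inE => /andP[/cc' -> _].
Qed.

Definition separating s b := forall u, (forall i, i \in s -> dot u (b i) = 0) -> u = 0.

Lemma quad_gt0 s c b u : (forall i, 0 < c i) -> separating s b -> u != 0 ->
  0 < dot (u *m gram s c b) u.
Proof.
move=> c0 sep u0; rewrite dot_gram lt_def; apply/andP; split; last first.
  by apply: sumr_ge0 => i _; rewrite -mulrA mulr_ge0 ?(ltW (c0 i))// -expr2 sqr_ge0.
apply: contra u0 => /eqP S0; apply/eqP; apply: sep => i si.
have ge0 j : true -> 0 <= c j * dot u (b j) * dot u (b j).
  by move=> _; rewrite -mulrA mulr_ge0 ?(ltW (c0 j))// -expr2 sqr_ge0.
move/eqP: S0; rewrite psumr_eq0 // => /allP /(_ _ si) /=.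
by rewrite -mulrA mulf_eq0 gt_eqF //= mulf_eq0 orbb => /eqP.
Qed.

Lemma posdef_unit (A : 'M[R]_n) : (forall u, u != 0 -> 0 < dot (u *m A) u) -> A \in unitmx.
Proof.
move=> pd; rewrite -row_free_unit; apply: inj_row_free => v vA.
apply/eqP; apply: contraT => /pd; rewrite vA /dot mul0mx mxE ltxx //.
Qed.

Lemma dot_gt0 u : u != 0 -> 0 < dot u u.
Proof.
move=> u0; rewrite dotE lt_def; apply/andP; split; last first.
  by apply: sumr_ge0 => i _; rewrite -expr2 sqr_ge0.
apply: contra u0; rewrite psumr_eq0 => [|i _]; last by rewrite -expr2 sqr_ge0.
move=> /allP h; apply/eqP/rowP => j; rewrite mxE.
by have := h j (mem_index_enum _); rewrite /= mulf_eq0 orbb => /eqP.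
Qed.

(* Homotopy to the identity: the determinant of t A + (1 - t) I has no zero on [0, 1]. *)
Lemma posdef_det_gt0 (A : 'M[R]_n) :
  (forall u, u != 0 -> 0 < dot (u *m A) u) -> 0 < \det A.
Proof.
move=> pd.
pose P : 'M[{poly R}]_n := 'X *: map_mx polyC A + (1 - 'X) *: 1%:M.
have Pt t : (\det P).[t] = \det (t *: A + (1 - t) *: 1%:M).
  rewrite -horner_evalE -det_map_mx; congr (\det _); apply/matrixP => i j.
  by rewrite !mxE; case: (i == j); rewrite [LHS]/= /horner_eval !hornerE.
rewrite lt_neqAle eq_sym -unitfE -unitmxE posdef_unit //= leNgt; apply/negP => dA.
have iv : (- \det P).[0] <= 0 <= (- \det P).[1].
  rewrite !hornerN !Pt scale0r add0r subr0 scale1r det1 subrr scale0r addr0 scale1r.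
  by rewrite oppr_le0 ler01 oppr_ge0 (ltW dA).
have [t /andP[t0 t1] /rootP] := poly_ivt ler01 iv.
apply/eqP; rewrite hornerN oppr_eq0 Pt -unitfE -unitmxE; apply: posdef_unit => u u0.
rewrite mulmxDr -!scalemxAr mulmx1 /dot mulmxDl -!scalemxAl mxE [X in _ < X + _]mxE [X in _ < _ + X]mxE.
have := pd u u0; have := dot_gt0 u0; rewrite /dot => h1 h2.
have [->|t0'] := eqVneq t 0; first by lra.
have tp : 0 < t by rewrite lt_def t0' t0.
by apply: ltr_wpDr; [apply: mulr_ge0; [lra|exact: ltW]|exact: mulr_gt0].
Qed.

Section Potential.
Variables (s : seq I) (c : I -> R) (b : I -> 'rV[R]_n).
Hypotheses (c0 : forall i, 0 < c i) (sep : separating s b).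
Let A := gram s c b.

Lemma gram_det_gt0 : 0 < \det A.
Proof. by apply: posdef_det_gt0 => u; exact: quad_gt0. Qed.

Lemma gram_unit : A \in unitmx.
Proof. by apply: posdef_unit => u; exact: quad_gt0. Qed.

(** [u *m invmx A] represents the functional [dot u] for the form [A]; when [u] is a gradient row,
    it is the potential of a unit dipole. *)
Lemma gram_potential u v :
  \sum_(i <- s) c i * dot (u *m invmx A) (b i) * dot v (b i) = dot u v.
Proof. by rewrite -dot_gram -/A mulmxKV // gram_unit. Qed.

(** Foster's identity: the trace of [invmx A *m A], expanded over the edges. *)
Lemma gram_foster : \sum_(i <- s) c i * dot (b i *m invmx A) (b i) = n%:R.
Proof.
rewrite -(@mxtrace1 R n) -(mulVmx gram_unit) {2}/A /gram mulmx_sumr raddf_sum /=.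
apply: eq_bigr => i _; rewrite -scalemxAr linearZ /=; congr (_ * _).
by rewrite mulmxA mxtrace_mulC mulmxA trace_mx11 /dot.
Qed.

Lemma gram_det_update a w :
  \det (A + a *: (w^T *m w)) = \det A * (1 + a * dot (w *m invmx A) w).
Proof.
rewrite scalemxAl det_rank1_update ?gram_unit //; congr (_ * (1 + _)).
by rewrite -scalemxAr mxE.
Qed.

End Potential.
End Gram.

(** * Edges and gradients in a box *)

Lemma ler_sum_uniq (R : numDomainType) (I : eqType) (s t : seq I) (F : I -> R) :
  uniq s -> uniq t -> {subset s <= t} -> (forall i, 0 <= F i) ->
  \sum_(i <- s) F i <= \sum_(i <- t) F i.
Proof.
move=> us ut st F0.
have p : perm_eq (s ++ [seq i <- t | i \notin s]) t.
  apply: uniq_perm => //.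
    rewrite cat_uniq us filter_uniq // andbT.
    by apply/hasPn => f; rewrite mem_filter => /andP[].
  by move=> f; rewrite mem_cat mem_filter; case fs : (f \in s) => //=; rewrite (st f fs).
by rewrite -(perm_big _ p) big_cat /= lerDl sumr_ge0.
Qed.

Definition setb (E : eqType) (e : E) (b : bool) (k : E -> bool) : E -> bool :=
  fun f => if f == e then b else k f.

Section Boxes.
Variable d : nat.
Implicit Types (N : nat) (x : site d) (e : edge d).

Definition in_edges N e := in_box N e.1 && in_box N (shift e.1 e.2).

Definition edges N : seq (edge d) :=
  [seq (emb vi.1, vi.2) | vi : box d N * 'I_d <-
     enum [pred vi : box d N * 'I_d | in_box N (shift (emb vi.1) vi.2)]].

Lemma in_box_emb N (v : box d N) : in_box N (emb v).
Proof.
by apply/forallP => j; rewrite ffunE; have := ltn_ord (v j); move: (nat_of_ord _) => a; lia.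
Qed.

Lemma emb_inj N : injective (@emb d N).
Proof.
move=> v w /ffunP h; apply/ffunP => j; apply/val_inj/eqP.
by have := h j; rewrite !ffunE => /addIr /eqP.
Qed.

Lemma in_boxP N x : reflect (exists v : box d N, emb v = x) (in_box N x).
Proof.
apply: (iffP idP) => [/forallP h|[v <-]]; last exact: in_box_emb.
have lt j : (absz (x j + N%:Z)%R < 2 * N + 1)%N by have := h j; move: (x j) => y; lia.
exists [ffun j => Ordinal (lt j)]; apply/ffunP => j; rewrite !ffunE /=.
by have := h j; move: (x j) => y; lia.
Qed.

Lemma in_box_le N M x : (N <= M)%N -> in_box N x -> in_box M x.
Proof. by move=> NM /forallP h; apply/forallP => j; have := h j; move: (x j) => y; lia. Qed.

Lemma in_box_shift n m x i : (n < m)%N -> in_box n x -> in_box m (shift x i).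
Proof.
move=> nm /forallP h; apply/forallP => j; rewrite ffunE; have := h j.
by case: ifP => _; move: (x j) => z; lia.
Qed.

Lemma in_box_unshift n m x i : (n < m)%N -> in_box n (shift x i) -> in_box m x.
Proof.
move=> nm /forallP h; apply/forallP => j; have := h j; rewrite ffunE.
by case: ifP => _; move: (x j) => z; lia.
Qed.

Lemma mem_edges N e : (e \in edges N) = in_edges N e.
Proof.
apply/mapP/idP => [[vi]|/andP[/in_boxP[v ve] h]].
  by rewrite mem_enum inE => h ->; rewrite /in_edges in_box_emb.
by exists (v, e.2); rewrite ?mem_enum ?inE /= ve //; case: e {ve h}.
Qed.

Lemma edges_uniq N : uniq (edges N).
Proof.
rewrite map_inj_uniq ?enum_uniq // => -[v i] [w j] /= [/emb_inj -> ->] //.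
Qed.

Lemma in_edges_le N M e : (N <= M)%N -> in_edges N e -> in_edges M e.
Proof. by move=> NM /andP[h1 h2]; rewrite /in_edges !(in_box_le NM). Qed.

Lemma big_edges (V : nmodType) N (F : edge d -> V) :
  \sum_(e <- edges N) F e =
  \sum_(v : box d N) \sum_(i < d | in_box N (shift (emb v) i)) F (emb v, i).
Proof. by rewrite big_map big_enum pair_big_dep. Qed.

Lemma in_box_exists e : exists N, in_edges N e.
Proof.
have h x : exists N, in_box N x.
  exists (\max_j `|x j|%N)%N; apply/forallP => j.
  have : (`|x j| <= \max_i `|x i|)%N by exact: (@leq_bigmax _ (fun i => `|x i|%N)).
  by move: (x j) (\max__ _)%N => y m; lia.
have [N hN] := h e.1; have [M hM] := h (shift e.1 e.2).
exists (maxn N M); apply/andP; split; [apply: in_box_le hN|apply: in_box_le hM];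
  by rewrite ?leq_maxl ?leq_maxr.
Qed.

Definition tr (x : site d) e : edge d := ([ffun j => e.1 j + x j], e.2).

Lemma tr_inj x : injective (tr x).
Proof.
move=> [y i] [z j] [] /ffunP h ->; congr (_, _); apply/ffunP => l.
by have := h l; rewrite !ffunE => /addIr.
Qed.

Lemma in_edges_tr N M x e : in_box M x -> in_edges N e -> in_edges (N + M) (tr x e).
Proof.
move=> /forallP xM /andP[/forallP h1 /forallP h2]; apply/andP; split; apply/forallP => j.
  by rewrite ffunE; have := h1 j; have := xM j; move: (x j) (e.1 j) => a b; lia.
rewrite !ffunE; have := h2 j; have := xM j; rewrite ffunE /=.
by case: ifP => _; move: (x j) (e.1 j) => a b; lia.
Qed.

Variable R : realType.
Implicit Types u : site d -> R.

Definition grad u e : R := u (shift e.1 e.2) - u e.1.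

(** Connectedness of the box: a step towards the origin in a nonzero coordinate stays inside and
    lowers the l1 norm, on which the induction runs. *)
Lemma grad0_const N u : (forall e, in_edges N e -> grad u e = 0) ->
  forall x, in_box N x -> u x = u [ffun=> 0].
Proof.
move=> h x; move: {2}(\sum_j `|x j|)%N (leqnn (\sum_j `|x j|)%N) => n.
elim: n x => [|n IH] x xn xN.
  congr u; apply/ffunP => j; rewrite ffunE; move: xn.
  by rewrite leqn0 sum_nat_eq0 => /forallP/(_ j); rewrite implyTb absz_eq0 => /eqP.
case: (pickP (fun j => x j != 0)) => [j xj|x0]; last first.
  by congr u; apply/ffunP => j; rewrite ffunE; have /negbFE/eqP := x0 j.
have sumj (y : site d) : (`|y j| < `|x j|)%N -> (forall i, i != j -> y i = x i) ->
    (\sum_i `|y i| <= n)%N.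
  move=> yj yi; move: xn; rewrite (bigD1 j) //= [in X in _ -> X](bigD1 j) //=.
  have -> : (\sum_(i < d | i != j) `|y i| = \sum_(i < d | i != j) `|x i|)%N.
    by apply: eq_bigr => i ij; rewrite yi.
  by set s := (\sum_(i < d | i != j) `|x i|)%N; lia.
have := forallP xN; have [xp|xn'] : 0 < x j \/ x j < 0 by lia.
  move=> hx; pose y : site d := [ffun i => if i == j then x i - 1 else x i].
  have sy : shift y j = x by apply/ffunP => i; rewrite !ffunE; case: eqP => // _; rewrite subrK.
  have yN : in_box N y.
    by apply/forallP => i; rewrite ffunE; have := hx i; case: eqP => [->|_]; move: (x j) xp (x i) => a ? b; lia.
  have := h (y, j); rewrite /in_edges /grad /= sy yN xN => /(_ isT)/eqP; rewrite subr_eq0 => /eqP ->.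
  apply: IH => //; apply: sumj; rewrite ?ffunE ?eqxx; first by move: (x j) xp => a; lia.
  by move=> i ij; rewrite ffunE (negbTE ij).
move=> hx; have sN : in_box N (shift x j).
  by apply/forallP => i; rewrite ffunE; have := hx i; case: eqP => [->|_]; move: (x j) xn' (x i) => a ? b; lia.
have := h (x, j); rewrite /in_edges /grad /= sN xN => /(_ isT)/eqP; rewrite subr_eq0 => /eqP <-.
apply: IH => //; apply: sumj; rewrite ?ffunE ?eqxx; first by move: (x j) xn' => a; lia.
by move=> i ij; rewrite ffunE (negbTE ij).
Qed.

Variable q : R.

Definition form N (k : cfg d) (u v : site d -> R) : R :=
  \sum_(e <- edges N) cond q k e * grad u e * grad v e.

(** The value 0 off the box becomes the Dirichlet boundary condition when the form is taken over a
    larger box. *)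
Definition ext N (f : box d N -> R) : site d -> R :=
  fun x => if [pick v | emb v == x] is Some v then f v else 0.

Lemma ext_emb N (f : box d N -> R) (v : box d N) : ext f (emb v) = f v.
Proof.
rewrite /ext; case: pickP => [w /eqP/emb_inj -> //|/(_ v)]; by rewrite eqxx.
Qed.

Lemma sum_emb_eq N x (F : box d N -> R) :
  \sum_(w : box d N) (if emb w == x then F w else 0) =
  if [pick w : box d N | emb w == x] is Some w then F w else 0.
Proof.
rewrite -big_mkcond; case: pickP => [w /eqP wx|h]; last by rewrite big_pred0.
rewrite (big_pred1 w) // => v /=; rewrite -wx; apply/eqP/eqP => [|-> //]; exact: emb_inj.
Qed.

(** Summation by parts: [adj] sees each edge from both endpoints, and symmetrising the double sum
    produces products of gradients. *)
Lemma lap_form N k (f h : box d N -> R) :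
  \sum_v (\sum_w adj q k v w * (f v - f w)) * h v = form N k (ext f) (ext h).
Proof.
pose a (v w : box d N) i := if emb w == shift (emb v) i then cond q k (emb v, i) else 0.
have -> : \sum_v (\sum_w adj q k v w * (f v - f w)) * h v =
   \sum_v \sum_w (\sum_i a v w i) * (f v - f w) * h v +
   \sum_v \sum_w (\sum_i a w v i) * (f v - f w) * h v.
  rewrite -big_split; apply: eq_bigr => v _; rewrite -big_split mulr_suml.
  by apply: eq_bigr => w _; rewrite /adj big_split /=; ring.
rewrite [X in _ + X]exchange_big -big_split /= /form big_edges; apply: eq_bigr => v _.
rewrite -big_split /=.
transitivity (\sum_w \sum_i a v w i * (f w - f v) * (h w - h v)).
  by apply: eq_bigr => w _; rewrite -!mulr_suml; ring.
rewrite exchange_big [RHS]big_mkcond /=; apply: eq_bigr => i _.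
rewrite (eq_bigr (fun w => if emb w == shift (emb v) i then
   cond q k (emb v, i) * (f w - f v) * (h w - h v) else 0)); last first.
  by move=> w _; rewrite /a; case: ifP => // _; rewrite !mul0r.
rewrite sum_emb_eq /grad /= !ext_emb /ext; case: pickP => [w /eqP <-|h0].
  by rewrite in_box_emb.
case: ifP => // /in_boxP [w /eqP]; by rewrite h0.
Qed.

End Boxes.

(** * Effective resistance *)

Section Resistance.
Variables (d : nat) (R : realType) (q : R).
Hypothesis q1 : 1 <= q.
Implicit Types (N : nat) (e : edge d) (k : cfg d).

Lemma cond_gt0 k e : 0 < cond q k e.
Proof. by rewrite /cond; case: ifP => _ //; exact: lt_le_trans q1. Qed.

Lemma cond_ge1 k e : 1 <= cond q k e.
Proof. by rewrite /cond; case: ifP. Qed.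

(** * The Laplacian on zero-sum functions in coordinates *)

Section Free.
Variable N : nat.
Local Notation zs := (subvs_of (zerosum d R N)).
Local Notation m := (\dim (fullv : {vspace zs})).
Local Notation B := (vbasis (fullv : {vspace zs})).

Definition zs_fun (u : zs) : box d N -> R := fun v => (vsval u : {ffun box d N -> R^o}) v.

Lemma sumf_sum (f : {ffun box d N -> R^o}) : sumf d R N f = \sum_v f v.
Proof.
have lin : linear (fun f : {ffun box d N -> R^o} => \sum_v f v : R^o).
  move=> a u v; rewrite scaler_sumr -big_split; apply: eq_bigr => x _ /=; by rewrite !ffunE.
pose F : {linear {ffun box d N -> R^o} -> R^o} :=
  HB.pack (fun f : {ffun box d N -> R^o} => \sum_v f v : R^o) (GRing.isLinear.Build _ _ _ _ _ lin).
exact: (lfunE F f).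
Qed.

Lemma mem_zerosum (f : {ffun box d N -> R^o}) : (f \in zerosum d R N) = (\sum_v f v == 0).
Proof. by rewrite memv_ker sumf_sum. Qed.

Lemma zs_fun_sum (u : zs) : \sum_v zs_fun u v = 0.
Proof. by apply/eqP; rewrite -(mem_zerosum (vsval u)) subvsP. Qed.

Lemma lap0E k (u : zs) v :
  zs_fun (lap0 q k N u) v = \sum_w adj q k v w * (zs_fun u v - zs_fun u w).
Proof.
have lin : linear (fun u : zs => vsproj (zerosum d R N) (lap q k (vsval u))).
  move=> a x y; rewrite -linearP; congr (vsproj _ _); apply/ffunP => i; rewrite !ffunE.
  rewrite scaler_sumr -big_split; apply: eq_bigr => w _ /=.
  by rewrite !ffunE /GRing.scale /=; ring.
pose F : {linear zs -> zs} :=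
  HB.pack (fun u : zs => vsproj (zerosum d R N) (lap q k (vsval u)))
    (GRing.isLinear.Build _ _ _ _ _ lin).
have -> : lap0 q k N u = F u by exact: (lfunE F u).
rewrite /zs_fun /= vsprojK ?ffunE //.
rewrite mem_zerosum (eq_bigr (fun v => (\sum_w adj q k v w * (zs_fun u v - zs_fun u w)) * 1)).
  rewrite (lap_form q k (zs_fun u) (fun=> 1)) /form big1_seq // => e /andP[_].
  rewrite mem_edges => /andP[/in_boxP[x xe] /in_boxP[y ye]].
  by rewrite /grad -ye -xe !ext_emb subrr mulr0.
by move=> x _; rewrite mulr1 ffunE.
Qed.

Definition zs_row e : 'rV[R]_m := \row_i grad (ext (zs_fun B`_i)) e.

Definition zs_vec (u : 'rV[R]_m) : box d N -> R :=
  zs_fun (\sum_i u 0 i *: B`_i).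

Lemma zs_vecE u v : zs_vec u v = \sum_i u 0 i * zs_fun B`_i v.
Proof. by rewrite /zs_vec /zs_fun linear_sum /= sum_ffunE; apply: eq_bigr => i _; rewrite ffunE. Qed.

Lemma ext_zs_vec u x : ext (zs_vec u) x = \sum_i u 0 i * ext (zs_fun B`_i) x.
Proof.
rewrite /ext; case: pickP => [v _|_]; first exact: zs_vecE.
by rewrite big1 // => i _; rewrite mulr0.
Qed.

Lemma dot_zs_row u e : dot u (zs_row e) = grad (ext (zs_vec u)) e.
Proof.
rewrite dotE /grad !ext_zs_vec -sumrB; apply: eq_bigr => i _.
by rewrite mxE /grad; ring.
Qed.

Lemma zs_vec_eq0 u : (forall v, zs_vec u v = 0) -> u = 0.
Proof.
move=> h; have /freeP fr := basis_free (vbasisP (fullv : {vspace zs})).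
have u0 : \sum_(i < m) u 0 i *: B`_i = 0.
  by apply/val_inj/ffunP => v; have := h v; rewrite /zs_vec /zs_fun => ->; rewrite linear0 ffunE.
by apply/rowP => i; rewrite (fr _ u0) mxE.
Qed.

Lemma card_box_gt0 : (0 < #|{: box d N}|)%N.
Proof. by rewrite card_ffun card_ord expn_gt0 addn1. Qed.

Lemma separating_zs_row : separating (edges d N) zs_row.
Proof.
move=> u h; apply: zs_vec_eq0 => v.
have c e : in_edges N e -> grad (ext (zs_vec u)) e = 0.
  by rewrite -mem_edges => /h; rewrite dot_zs_row.
have cst w : zs_vec u w = zs_vec u v.
  by rewrite -(ext_emb (zs_vec u) w) -(ext_emb (zs_vec u) v) !(grad0_const c) ?in_box_emb.
have := zs_fun_sum (\sum_i u 0 i *: B`_i).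
rewrite -/(zs_vec u) (eq_bigr (fun=> zs_vec u v)) // sumr_const => /eqP.
by rewrite mulrn_eq0 -leqn0 leqNgt card_box_gt0 => /eqP.
Qed.

(** Subtracting the mean makes any function zero-sum without changing gradients, so the variational
    formulas admit arbitrary test functions. *)
Lemma zs_rowK (w : site d -> R) : exists u, forall e, in_edges N e -> dot u (zs_row e) = grad w e.
Proof.
pose a := (\sum_(v : box d N) w (emb v)) / #|{: box d N}|%:R.
pose f : {ffun box d N -> R^o} := [ffun v => w (emb v) - a].
have fz : f \in zerosum d R N.
  rewrite mem_zerosum (eq_bigr (fun v => w (emb v) - a)) => [|v _]; last by rewrite ffunE.
  rewrite sumrB sumr_const -mulr_natr /a divfK ?subrr // pnatr_eq0 -lt0n; exact: card_box_gt0.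
pose u : 'rV[R]_m := \row_i coord B i (vsproj _ f).
exists u => e /andP[/in_boxP[x xe] /in_boxP[y ye]].
have uE v : zs_vec u v = w (emb v) - a.
  rewrite /zs_vec (eq_bigr (fun i => coord B i (vsproj (zerosum d R N) f) *: B`_i)).
    by rewrite -coord_vbasis ?memvf // /zs_fun vsprojK // ffunE.
  by move=> i _; rewrite mxE.
by rewrite dot_zs_row /grad -ye -xe !ext_emb !uE; ring.
Qed.

Lemma dim_zerosum_le : (m <= #|{: box d N}|)%N.
Proof.
rewrite dimvf /dim /=; apply: leq_trans (dimvS (subvf _)) _.
by rewrite dimvf /dim /= muln1.
Qed.

Definition gradmx k := gram (edges d N) (cond q k) zs_row.

(** The basis underlying [detLap] need not be orthonormal. Its l2 Gram matrix corrects for this and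
    is the same for all configurations, so it cancels in ratios. *)
Definition l2mx : 'M[R]_m := gram (enum {: box d N}) (fun=> 1) (fun v => \row_i zs_fun B`_i v).

Lemma dot_eval u v : dot u (\row_i zs_fun B`_i v) = zs_vec u v.
Proof. by rewrite dotE zs_vecE; apply: eq_bigr => i _; rewrite mxE. Qed.

Lemma l2mx_det_gt0 : 0 < \det l2mx.
Proof.
apply: gram_det_gt0 => [_|u h]; first exact: ltr01.
by apply: zs_vec_eq0 => v; rewrite -dot_eval; apply: h; rewrite mem_enum.
Qed.

(** Summation by parts in coordinates: the matrix of the operator times the l2 Gram matrix is the
    matrix of the Dirichlet form. *)
Lemma detLap_gradmx k : detLap q k N * \det l2mx = \det (gradmx k).
Proof.
rewrite /detLap -det_mulmx; congr (\det _); apply/matrixP => i j.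
have delta_dot (M : 'M[R]_m) : M i j = dot (delta_mx 0 i *m M) (delta_mx 0 j).
  by rewrite -rowE dotE (bigD1 j) //= !mxE !eqxx mulr1 big1 ?addr0 // => l /negbTE lj; rewrite !mxE eqxx lj mulr0.
have vec_delta l : zs_vec (delta_mx 0 l) = zs_fun B`_l.
  rewrite /zs_vec (bigD1 l) //= mxE !eqxx scale1r big1 ?addr0 // => r /negbTE rl.
  by rewrite mxE eqxx rl scale0r.
rewrite !delta_dot mulmxA !dot_gram passmx.mul_mxof passmx.vecof_delta.
set u := passmx.rVof _ _.
have uE v : zs_vec u v = \sum_w adj q k v w * (zs_fun B`_i v - zs_fun B`_i w).
  rewrite -lap0E /zs_vec; congr (zs_fun _ v).
  rewrite -[RHS](passmx.rVofK (vbasisP fullv)) //.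
transitivity (form q N k (ext (zs_fun B`_i)) (ext (zs_fun B`_j))).
  rewrite -lap_form big_enum /=; apply: eq_bigr => v _.
  by rewrite !dot_eval mul1r uE vec_delta.
by apply: eq_bigr => e _; rewrite !dot_zs_row !vec_delta.
Qed.

End Free.

(** * Resistances, dipole potentials and Rayleigh monotonicity *)

Definition res N k e : R := dot (zs_row N e *m invmx (gradmx N k)) (zs_row N e).

(** The potential of a unit dipole at [e]: by [form_pot], pairing with it in the Dirichlet form
    reads off the gradient along [e]. *)
Definition pot N k e : site d -> R := ext (zs_vec (zs_row N e *m invmx (gradmx N k))).

Lemma grad_pot N k e : grad (pot N k e) e = res N k e.
Proof. by rewrite /pot -dot_zs_row. Qed.

Lemma form_pot N k e w : in_edges N e -> form q N k (pot N k e) w = grad w e.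
Proof.
move=> eN; have [u uw] := zs_rowK N w.
rewrite -(uw e eN) [RHS]dotC -(gram_potential (cond_gt0 k) (@separating_zs_row N)).
rewrite /form !big_seq; apply: eq_bigr => f; rewrite mem_edges => fN.
by rewrite -(uw f fN) /pot -dot_zs_row.
Qed.

Lemma detLap_gt0 N k : 0 < detLap q k N.
Proof.
have := gram_det_gt0 (cond_gt0 k) (@separating_zs_row N).
by rewrite -/(gradmx N k) -detLap_gradmx pmulr_lgt0 // l2mx_det_gt0.
Qed.

Lemma foster_le N k : \sum_(e <- edges d N) cond q k e * res N k e <= #|{: box d N}|%:R.
Proof.
by rewrite /res (gram_foster (cond_gt0 k) (@separating_zs_row N)) ler_nat dim_zerosum_le.
Qed.

Lemma detLap_setb N k e : in_edges N e ->
  detLap q (setb e true k) N =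
  detLap q (setb e false k) N * (1 + (q - 1) * res N (setb e false k) e).
Proof.
move=> eN; apply: (mulIf (lt0r_neq0 (l2mx_det_gt0 N))).
rewrite mulrAC !detLap_gradmx.
rewrite -(gram_det_update (cond_gt0 _) (@separating_zs_row N)); congr (\det _).
rewrite /gradmx (@gram_change _ _ _ _ (cond q (setb e true k)) (cond q (setb e false k)) _ e).
- by rewrite /cond /setb eqxx.
- exact: edges_uniq.
- by rewrite mem_edges.
- by move=> f /negbTE fe; rewrite /cond /setb fe.
Qed.

Lemma form_sym N k u v : form q N k u v = form q N k v u.
Proof. by apply: eq_bigr => e _; rewrite mulrAC. Qed.

Lemma form_ge0 N k u : 0 <= form q N k u u.
Proof.
by apply: sumr_ge0 => e _; rewrite -mulrA mulr_ge0 ?(ltW (cond_gt0 _ _)) // -expr2 sqr_ge0.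
Qed.

Lemma form_subr N k u v : form q N k (u \- v) (u \- v) =
  form q N k u u - 2 * form q N k u v + form q N k v v.
Proof.
rewrite /form mulr_sumr -sumrB -big_split; apply: eq_bigr => e _ /=.
by rewrite /grad /=; ring.
Qed.

(** Expand the nonnegative form of [pot N k e \- w]. Equality holds at the potential, so lower
    bounds on resistances need only a test function. *)
Lemma res_variational N k e w : in_edges N e -> 2 * grad w e - form q N k w w <= res N k e.
Proof.
move=> eN; have gw := @form_pot N k e^~ eN; have ge := grad_pot N k e; set g := pot N k e in gw ge.
have := form_ge0 N k (g \- w); rewrite form_subr !gw ge; lra.
Qed.

(** The potential for the larger box and larger conductances is a test function for the smaller
    ones. *)
Lemma res_le N M k k' e : (N <= M)%N -> in_edges N e ->
  (forall f, in_edges N f -> k f -> k' f) -> res M k' e <= res N k e.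
Proof.
move=> NM eN kk'; have eM := in_edges_le NM eN.
have gw := @form_pot M k' e^~ eM; have ge := grad_pot M k' e; set g := pot M k' e in gw ge.
apply: le_trans (res_variational k g eN).
suff : form q N k g g <= form q M k' g g by rewrite gw ge; lra.
have pos k0 (f : edge d) : 0 <= cond q k0 f * grad g f * grad g f.
  by rewrite -mulrA mulr_ge0 ?(ltW (cond_gt0 _ _)) // -expr2 sqr_ge0.
apply: (@le_trans _ _ (form q N k' g g)).
  rewrite /form !big_seq; apply: ler_sum => f; rewrite mem_edges => fN.
  rewrite -!mulrA ler_wpM2r // -?expr2 ?sqr_ge0 //.
  rewrite /cond; have := kk' f fN; case: (k f) => [->//|_]; by case: (k' f).
apply: ler_sum_uniq; rewrite ?edges_uniq // => f; rewrite !mem_edges; exact: in_edges_le.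
Qed.

Lemma detLap_local N k k' : (forall f, in_edges N f -> k f = k' f) ->
  detLap q k N = detLap q k' N.
Proof.
move=> kk'; apply: (mulIf (lt0r_neq0 (l2mx_det_gt0 N))); rewrite !detLap_gradmx.
congr (\det _); rewrite /gradmx /gram !big_seq; apply: eq_bigr => f.
by rewrite mem_edges => fN; rewrite /cond kk'.
Qed.

Lemma res_bounds N k e : in_edges N e -> 0 <= res N k e <= 1.
Proof.
move=> eN; have gw := @form_pot N k e^~ eN; have ge := grad_pot N k e; set g := pot N k e in gw ge.
have h : form q N k g g = res N k e by rewrite gw.
rewrite -h form_ge0 h /=; have r0 : 0 <= res N k e by rewrite -h form_ge0.
(* The term at [e] alone of the energy [res N k e] is at least [res N k e] squared, since
   conductances are at least 1. *)
have : res N k e * res N k e <= res N k e.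
  rewrite -[X in _ <= X]h /form (big_rem e) ?mem_edges //= ge -[X in X <= _]addr0.
  apply: lerD; first by rewrite -mulrA ler_peMl ?mulr_ge0 ?cond_ge1.
  by apply: sumr_ge0 => f _; rewrite -mulrA mulr_ge0 ?(ltW (cond_gt0 _ _)) // -expr2 sqr_ge0.
by have [-> //|r0'] := eqVneq (res N k e) 0; rewrite ger_pMr // lt_def r0' r0.
Qed.

Lemma grad_pot_sym N k e f : in_edges N e -> in_edges N f ->
  grad (pot N k e) f = grad (pot N k f) e.
Proof. by move=> eN fN; rewrite -(form_pot k _ fN) form_sym form_pot. Qed.

Lemma sum_grad_pot_le N k f : in_edges N f ->
  \sum_(e <- edges d N) grad (pot N k e) f ^+ 2 <= 1.
Proof.
move=> fN; have /andP[_] := res_bounds k fN; apply: le_trans.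
rewrite -grad_pot -(form_pot k _ fN) /form !big_seq; apply: ler_sum => e.
rewrite mem_edges => eN; rewrite (grad_pot_sym k eN fN) expr2 -mulrA.
by rewrite ler_peMl ?cond_ge1 // -expr2 sqr_ge0.
Qed.

(** The potential for [k] serves as test function for [k'], so the bound is linear in the change of
    conductance and involves gradients in [k] only. *)
Lemma res_sensitivity N k k' e : in_edges N e ->
  res N k e - res N k' e <=
  \sum_(f <- edges d N) (cond q k' f - cond q k f) * grad (pot N k e) f ^+ 2.
Proof.
move=> eN; have := res_variational k' (pot N k e) eN.
have h : form q N k (pot N k e) (pot N k e) = res N k e by rewrite form_pot ?grad_pot.
suff -> : \sum_(f <- edges d N) (cond q k' f - cond q k f) * grad (pot N k e) f ^+ 2 =
   form q N k' (pot N k e) (pot N k e) - form q N k (pot N k e) (pot N k e).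
  by rewrite grad_pot h; lra.
by rewrite /form -sumrB; apply: eq_bigr => f _; ring.
Qed.

Lemma pot_unique N k e (g : site d -> R) f : in_edges N e -> in_edges N f ->
  (forall w, form q N k g w = grad w e) -> grad g f = grad (pot N k e) f.
Proof.
move=> eN fN gw; have h : form q N k (g \- pot N k e) (g \- pot N k e) = 0.
  have e1 : grad g e = grad (pot N k e) e by rewrite -(form_pot k g eN) form_sym gw.
  by rewrite form_subr !gw form_pot // e1; lra.
move/eqP: h; rewrite /form psumr_eq0 => [/allP /(_ f)|f' _]; last first.
  by rewrite -mulrA mulr_ge0 ?(ltW (cond_gt0 _ _)) // -expr2 sqr_ge0.
rewrite mem_edges fN => /(_ isT); rewrite /= -mulrA mulf_eq0 gt_eqF ?cond_gt0 //= mulf_eq0 orbb.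
by rewrite /grad /=; move/eqP; lra.
Qed.

(** * The resistance of an edge that has been lowered *)

Definition res0 N k e := res N (setb e false k) e.

Lemma res0_bounds N k e : in_edges N e -> 0 <= res0 N k e <= 1.
Proof. exact: res_bounds. Qed.

Lemma cond_setb k e b f : f != e -> cond q (setb e b k) f = cond q k f.
Proof. by rewrite /cond /setb => /negbTE ->. Qed.

Lemma form_setb N k e u v : in_edges N e ->
  form q N k u v = form q N (setb e false k) u v + (cond q k e - 1) * grad u e * grad v e.
Proof.
move=> eN; have eE : e \in edges d N by rewrite mem_edges.
rewrite /form !(perm_big _ (perm_to_rem eE)) !big_cons /=.
rewrite [\sum_(f <- _) cond q k _ * _ * _](@eq_big_seq _ _ _ _ _ _
  (fun f => cond q (setb e false k) f * grad u f * grad v f)).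
  by rewrite {3}/cond /setb eqxx; ring.
by move=> f; rewrite mem_rem_uniq ?edges_uniq // inE => /andP[fe _]; rewrite cond_setb.
Qed.

(** Changing the conductance of [e] itself only rescales the potential of the dipole at [e]: the
    rescaled function solves the same weak equation, and gradients of solutions are unique. *)
Lemma grad_pot_setb N k e f : in_edges N e -> in_edges N f ->
  grad (pot N (setb e false k) e) f = (1 + (cond q k e - 1) * res0 N k e) * grad (pot N k e) f.
Proof.
move=> eN fN; set s := 1 + _.
have s0 : 0 < s.
  have /andP[r0 _] := res0_bounds k eN.
  by rewrite ltr_pwDl // mulr_ge0 // subr_ge0 cond_ge1.
pose g0 := pot N (setb e false k) e.
have formZ k0 a u v : form q N k0 (fun x => a * u x) v = a * form q N k0 u v.
  by rewrite /form mulr_sumr; apply: eq_bigr => f' _; rewrite /grad; ring.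
rewrite -(@pot_unique N k e (fun x => s^-1 * g0 x) f) // => [|w].
  by rewrite /g0 /grad -mulrBr mulVKf // gt_eqF.
rewrite formZ (form_setb _ _ _ eN) form_pot // grad_pot -/(res0 N k e).
by rewrite -[X in X + _]mul1r -mulrDl mulKf // gt_eqF.
Qed.

Lemma res0E N k e : in_edges N e -> res0 N k e = (1 + (cond q k e - 1) * res0 N k e) * res N k e.
Proof. by move=> eN; rewrite -grad_pot -grad_pot_setb // grad_pot. Qed.

Lemma cond_le k e : cond q k e <= q.
Proof. by rewrite /cond; case: ifP. Qed.

Lemma res0_factor N k e : in_edges N e -> 1 <= 1 + (cond q k e - 1) * res0 N k e <= q.
Proof.
move=> eN; have /andP[r0 r1] := res0_bounds k eN.
have c1 := cond_ge1 k e; have cq := cond_le k e.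
rewrite lerDl mulr_ge0 ?subr_ge0 //=.
apply: (@le_trans _ _ (1 + (cond q k e - 1) * 1)); last by lra.
by rewrite lerD2l ler_wpM2l // subr_ge0.
Qed.

(** * Functions vanishing outside a box: the wired box *)

Section Dirichlet.
Variables (n m : nat).
Hypotheses (d0 : (0 < d)%N) (nm : (n < m)%N).
Local Notation D := #|{: box d n}|.

Definition dir_vec (u : 'rV[R]_D) : box d n -> R := fun v => u 0 (enum_rank v).
Definition dir_row e : 'rV[R]_D :=
  \row_i grad (ext (fun v : box d n => (v == enum_val i)%:R)) e.

Lemma dot_dir_row u e : dot u (dir_row e) = grad (ext (dir_vec u)) e.
Proof.
have E x : ext (dir_vec u) x = \sum_i u 0 i * ext (fun v : box d n => (v == enum_val i)%:R) x.
  rewrite /ext; case: pickP => [v _|_]; last by rewrite big1 // => i _; rewrite mulr0.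
  rewrite (bigD1 (enum_rank v)) //= enum_rankK eqxx mulr1 big1 ?addr0 // => i.
  by rewrite -(inj_eq enum_val_inj) enum_rankK eq_sym => /negbTE ->; rewrite mulr0.
rewrite dotE /grad !E -sumrB; apply: eq_bigr => i _; by rewrite mxE /grad; ring.
Qed.

Lemma separating_dir_row : separating (edges d m) dir_row.
Proof.
move=> u h.
have c e : in_edges m e -> grad (ext (dir_vec u)) e = 0.
  by rewrite -mem_edges => /h; rewrite dot_dir_row.
(* A corner of box [m] lies outside box [n] because [d] is positive; the extension is 0 there, which
   fixes the constant. *)
pose y : site d := [ffun=> m%:Z].
have ym : in_box m y by apply/forallP => j; rewrite ffunE; lia.
have y0 : ext (dir_vec u) y = 0.
  rewrite /ext; case: pickP => // v /eqP vy.
  by have := forallP (in_box_emb v) (Ordinal d0); rewrite vy ffunE; lia.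
apply/rowP => i; rewrite mxE -[i]enum_valK -/(dir_vec u _) -(ext_emb (dir_vec u)).
rewrite (grad0_const c) -?(grad0_const c ym) //; apply: in_box_le (in_box_emb _); exact: ltnW.
Qed.

(** Dirichlet potentials of box [n] are admissible test functions in box [N], so free resistances
    dominate the Dirichlet ones, whose Foster sum is the dimension. *)
Lemma foster_ge N k : (m <= N)%N ->
  D%:R <= \sum_(e <- edges d m) cond q k e * res N k e.
Proof.
move=> mN.
rewrite -(gram_foster (cond_gt0 k) separating_dir_row) !big_seq; apply: ler_sum => e.
rewrite mem_edges => em; rewrite ler_wpM2l ?(ltW (cond_gt0 _ _)) //.
set A := gram _ _ _; set v := dir_row e *m invmx A.
have := res_variational k (ext (dir_vec v)) (in_edges_le mN em).
suff -> : form q N k (ext (dir_vec v)) (ext (dir_vec v)) = dot v (dir_row e).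
  by rewrite dot_dir_row; lra.
rewrite [RHS]dotC -(gram_potential (cond_gt0 k) separating_dir_row) -/A -/v /form.
have fE f : cond q k f * dot v (dir_row f) * dot v (dir_row f) =
  cond q k f * grad (ext (dir_vec v)) f * grad (ext (dir_vec v)) f by rewrite !dot_dir_row.
rewrite [RHS](eq_bigr _ (fun f _ => fE f)).
have out x : ~~ in_box n x -> ext (dir_vec v) x = 0.
  move=> xn; rewrite /ext; case: pickP => // w /eqP wx; by rewrite -wx in_box_emb in xn.
have g0 f : ~~ in_edges m f -> grad (ext (dir_vec v)) f = 0.
  move=> fm; rewrite /grad !out ?subrr //; apply: contra fm => fn; rewrite /in_edges.
    by rewrite (in_box_le (ltnW nm) fn) (in_box_shift _ nm).
  by rewrite (in_box_le (ltnW nm) fn) (in_box_unshift nm fn).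
rewrite (bigID (in_edges m)) /= [X in _ + X]big1 ?addr0 => [|f /g0 ->]; last by rewrite !mulr0.
rewrite -big_filter; apply: perm_big; apply: uniq_perm; rewrite ?filter_uniq ?edges_uniq //.
move=> f; rewrite mem_filter !mem_edges; case fm : (in_edges m f) => //=.
by rewrite (in_edges_le mN).
Qed.

End Dirichlet.

(* Inside the box [n] a discrepancy is charged through the total energy of a potential;
   outside, Foster's identities for the free and the wired box leave only a boundary term. *)
Lemma sum_res0_diff N n k k' : (0 < d)%N -> (n < N)%N -> (forall f, k f -> k' f) ->
  \sum_(e <- edges d n.+1) (res0 N k e - res0 N k' e) <=
  (q - 1) * q ^+ 2 * (\sum_(f <- edges d n.+1) (k f != k' f)%:R) +
  q ^+ 2 * (#|{: box d n.+1}|%:R - #|{: box d n}|%:R).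
Proof.
(* The hybrid [k2] separates the two kinds of discrepancy: it differs from [k] only inside box
   [n.+1] and from [k'] only outside. *)
move=> d0 nN kk'; pose k2 : cfg d := fun f => if in_edges n.+1 f then k' f else k f.
have kk2 f : k f -> k2 f by rewrite /k2; case: ifP => // _; exact: kk'.
have k2k' f : k2 f -> k' f by rewrite /k2; case: ifP => // _; exact: kk'.
have toN e : e \in edges d n.+1 -> in_edges N e by rewrite mem_edges; exact: in_edges_le.
rewrite (eq_bigr (fun e => (res0 N k e - res0 N k2 e) + (res0 N k2 e - res0 N k' e))); last first.
  by move=> e _; ring.
rewrite big_split; apply: lerD.
  have step e : e \in edges d n.+1 -> res0 N k e - res0 N k2 e <=
      \sum_(f <- edges d n.+1) (q - 1) * q ^+ 2 * (k f != k' f)%:R * grad (pot N k e) f ^+ 2.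
    intro eE; have eN := toN e eE; apply: (le_trans (res_sensitivity _ _ eN)).
    rewrite (bigID (in_edges n.+1)) /= [X in _ + X]big1 ?addr0 => [|f fn]; last first.
      by rewrite /cond /setb /k2 (negbTE fn) subrr mul0r.
    rewrite -big_filter (perm_big (edges d n.+1)) /=; last first.
      apply: uniq_perm; rewrite ?filter_uniq ?edges_uniq // => f; rewrite mem_filter.
      by case: (boolP (in_edges n.+1 f)); rewrite !mem_edges => fn; [rewrite (in_edges_le nN fn) fn|rewrite (negbTE fn)].
    rewrite !big_seq; apply: ler_sum => f fE; have fN := toN f fE; move: fE; rewrite mem_edges => fn.
    (* Origin of [q ^+ 2]: rescaling replaces the configurations [setb e false k], which vary with
       [e], by the single [k]. Only then does the symmetry of gradients in [e] and [f] apply to the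
       double sum. *)
    rewrite grad_pot_setb // exprMn.
    have s2 : (1 + (cond q k e - 1) * res0 N k e) ^+ 2 <= q ^+ 2.
      by have /andP[h1 h2] := res0_factor k eN; rewrite ler_sqr ?nnegrE //; lra.
    have cd : 0 <= cond q (setb e false k2) f - cond q (setb e false k) f <=
        (q - 1) * (k f != k' f)%:R.
      have qq : 0 <= q - 1 by rewrite subr_ge0.
      rewrite /cond /setb /k2 fn; case: eqP => _; first by rewrite subrr lexx mulr_ge0.
      have := kk' f; case: (k f) => [/(_ isT) ->|_]; first by rewrite subrr mulr0 lexx.
      by case: (k' f); rewrite /= ?mulr1 ?mulr0 ?subrr ?lexx ?qq.
    have g2 : 0 <= grad (pot N k e) f ^+ 2 by rewrite sqr_ge0.
    move: cd s2; set x := cond _ _ _ - _; set y := (k f != _)%:R; set z := (1 + _) ^+ 2.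
    move=> /andP[x0 xy] zq; have z0 : 0 <= z by rewrite sqr_ge0.
    have q20 : 0 <= q ^+ 2 by rewrite sqr_ge0.
    have : x * z <= ((q - 1) * y) * q ^+ 2 by apply: ler_pM.
    move=> /(ler_wpM2r g2); nra.
  apply: (@le_trans _ _ (\sum_(e <- edges d n.+1) \sum_(f <- edges d n.+1)
      (q - 1) * q ^+ 2 * (k f != k' f)%:R * grad (pot N k e) f ^+ 2)).
    by rewrite big_seq [X in _ <= X]big_seq; apply: ler_sum.
  rewrite exchange_big /= mulr_sumr big_seq [X in _ <= X]big_seq; apply: ler_sum => f fE; have fN := toN f fE.
  rewrite -mulr_sumr -[X in _ <= X]mulr1; apply: ler_wpM2l.
    by rewrite mulr_ge0 ?ler0n // mulr_ge0 ?sqr_ge0 // subr_ge0.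
  apply: le_trans (sum_grad_pot_le k fN); apply: ler_sum_uniq; rewrite ?edges_uniq // => e.
    by move=> eE; rewrite mem_edges; exact: toN.
  by rewrite sqr_ge0.
(* Inside box [n.+1] the conductances of [k2] and [k'] agree, so the difference of the [res0] is
   that of the [res] times two rescaling factors between 1 and [q]. *)
have step e : e \in edges d n.+1 -> res0 N k2 e - res0 N k' e <=
    q ^+ 2 * (cond q k2 e * res N k2 e - cond q k' e * res N k' e).
  move=> eE; have eN := toN e eE; move: eE; rewrite mem_edges => en.
  have cc : cond q k2 e = cond q k' e by rewrite /cond /k2 en.
  have := res0E k2 eN; have := res0E k' eN.
  have := res0_factor k2 eN; have := res0_factor k' eN; rewrite cc.
  have := res_le (leqnn N) eN (fun f _ => k2k' f); have := cond_ge1 k' e.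
  move: (cond q k' e) (res0 N k2 e) (res0 N k' e) (res N k2 e) (res N k' e) => c a b r s.
  set x := 1 + (c - 1) * b; set y := 1 + (c - 1) * a => c1 sr /andP[x1 xq] /andP[y1 yq] bE aE.
  have -> : a - b = (r - s) * (x * y).
    have -> : (r - s) * (x * y) = (y * r) * x - (x * s) * y by ring.
    by rewrite -aE -bE /x /y; ring.
  have rs : 0 <= r - s by rewrite subr_ge0.
  have xy : x * y <= q ^+ 2 by rewrite expr2 ler_pM //; lra.
  have := ler_wpM2l rs xy; have : r - s <= c * (r - s) by rewrite ler_peMl.
  have q20 : 0 <= q ^+ 2 by rewrite sqr_ge0.
  move=> /(ler_wpM2l q20); nra.
apply: (@le_trans _ _ (\sum_(e <- edges d n.+1)
    q ^+ 2 * (cond q k2 e * res N k2 e - cond q k' e * res N k' e))).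
  by rewrite big_seq [X in _ <= X]big_seq; apply: ler_sum.
rewrite -mulr_sumr; apply: ler_wpM2l; first by rewrite sqr_ge0.
rewrite sumrB; apply: lerB; last exact: foster_ge.
apply: le_trans (foster_le n.+1 k2); rewrite big_seq [X in _ <= X]big_seq; apply: ler_sum => e.
rewrite mem_edges => en; apply: ler_wpM2l; first exact: ltW (cond_gt0 _ _).
exact: res_le.
Qed.

(** The translate of box [N] sits inside box [N + M], so the translated potential of the latter is a
    test function. *)
Lemma res_tr N M x k e : in_box M x -> in_edges N e ->
  res (N + M) k (tr x e) <= res N (k \o tr x) e.
Proof.
move=> xM eN; have eM := in_edges_tr xM eN.
have gw := @form_pot _ k _ ^~ eM; have ge := grad_pot (N + M) k (tr x e).
set g := pot _ _ _ in gw ge.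
have gr f : grad (fun y => g [ffun j => y j + x j]) f = grad g (tr x f).
  rewrite /grad /tr /=; congr (g _ - _); apply/ffunP => j; rewrite !ffunE.
  by case: ifP => // _; ring.
apply: le_trans (res_variational _ (fun y => g [ffun j => y j + x j]) eN).
rewrite gr ge; suff : form q N (k \o tr x) (fun y => g [ffun j => y j + x j])
   (fun y => g [ffun j => y j + x j]) <= form q (N + M) k g g by rewrite gw ge; lra.
rewrite /form (eq_bigr (fun f => cond q k (tr x f) * grad g (tr x f) * grad g (tr x f))); last first.
  by move=> f _; rewrite !gr.
rewrite -(big_map (tr x) xpredT (fun f => cond q k f * grad g f * grad g f)).
apply: ler_sum_uniq; rewrite ?edges_uniq //.
- by rewrite map_inj_uniq ?edges_uniq //; exact: tr_inj.
- by move=> f /mapP[f' f'N ->]; rewrite mem_edges in_edges_tr // -mem_edges.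
- by move=> f; rewrite -mulrA mulr_ge0 ?(ltW (cond_gt0 _ _)) // -expr2 sqr_ge0.
Qed.

End Resistance.

(** * Finite-volume laws and their monotone coupling *)

Section Configurations.
Variable E : eqType.
Local Notation K := (E -> bool).
Implicit Types (e : E) (es : seq E) (k l : K) (b : bool).

Definition agree es l k := forall e, e \notin es -> k e = l e.
Definition lek k l := forall e, k e -> l e.

Lemma agree_refl es l : agree es l l. Proof. by []. Qed.

Lemma agree_cons e b es l k : agree es (setb e b l) k -> agree (e :: es) l k.
Proof.
by move=> a f; rewrite inE negb_or => /andP[/negbTE fe /a ->]; rewrite /setb fe.
Qed.

Lemma agree_setb e b es l k : agree (e :: es) l k -> agree es (setb e b l) (setb e b k).
Proof.
move=> a f fes; rewrite /setb; case: eqP => // /eqP fe.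
by apply: a; rewrite inE negb_or fe.
Qed.

Lemma lek_setb e b b' k l : (b -> b') -> lek k l -> lek (setb e b k) (setb e b' l).
Proof. by move=> bb kl f; rewrite /setb; case: ifP => // _; exact: kl. Qed.

Lemma setb_setb e b b' k : setb e b (setb e b' k) = setb e b k.
Proof. by apply/funext => f; rewrite /setb; case: (f == e). Qed.

Lemma setb_id e k : setb e (k e) k = k.
Proof. by apply/funext => f; rewrite /setb; case: eqP => // ->. Qed.

Fixpoint confs es l : seq K :=
  if es is e :: es' then confs es' (setb e true l) ++ confs es' (setb e false l) else [:: l].

Lemma mem_confs es l k : (k \in confs es l) <-> agree es l k.
Proof.
elim: es l => [|e es IH] l /=.
  by rewrite inE; split => [/eqP -> //|a]; apply/eqP/funext => e; rewrite a.
rewrite mem_cat; split => [/orP[]/IH|a]; try exact: agree_cons.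
apply/orP; case ke : (k e); [left|right]; apply/IH; rewrite -[k](setb_id e) ke; exact: agree_setb.
Qed.

Lemma confs_uniq es l : uniq es -> uniq (confs es l).
Proof.
elim: es l => [//|e es IH] l /= /andP[ees ues]; rewrite cat_uniq !IH // andbT /=.
apply/hasPn => k /mem_confs /(_ e ees); rewrite /setb eqxx => k0.
by apply/negP => /mem_confs /(_ e ees); rewrite k0 /setb eqxx.
Qed.

Variable R : realType.
Implicit Types (f g : K -> R).

(** * Laws determined by single-edge odds *)

Section Exp.
Variable rho : E -> K -> R.

(** Expectation under the law on the edges [es] with boundary condition [l] and conditional odds
    [rho]. The mass with [e] high over the mass with [e] low is the mean of [rho e] under the law
    with [e] low, hence the nested call. *)
Fixpoint gexp es l f : R :=
  if es is e :: es' then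
    let o := gexp es' (setb e false l) (rho e) in
    o / (1 + o) * gexp es' (setb e true l) f + (1 - o / (1 + o)) * gexp es' (setb e false l) f
  else f l.

Definition prob e es l : R :=
  gexp es (setb e false l) (rho e) / (1 + gexp es (setb e false l) (rho e)).

Lemma gexp_cons e es l f : gexp (e :: es) l f =
  prob e es l * gexp es (setb e true l) f + (1 - prob e es l) * gexp es (setb e false l) f.
Proof. by []. Qed.

Lemma gexp_lin es l a f g : gexp es l (fun k => a * f k + g k) = a * gexp es l f + gexp es l g.
Proof. by elim: es l => [//|e es IH] l; rewrite !gexp_cons !IH; ring. Qed.

Lemma gexp_cst es l c : gexp es l (fun=> c) = c.
Proof. by elim: es l => [//|e es IH] l; rewrite !gexp_cons !IH; ring. Qed.

Lemma gexp_sum (I : Type) (s : seq I) es l (F : I -> K -> R) :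
  gexp es l (fun k => \sum_(i <- s) F i k) = \sum_(i <- s) gexp es l (F i).
Proof.
elim: s => [|i s IH]; first by rewrite big_nil -[RHS](gexp_cst es l); congr gexp; apply/funext => k; rewrite big_nil.
rewrite big_cons -IH -[gexp es l (F i)]mul1r -gexp_lin; congr gexp; apply/funext => k.
by rewrite big_cons mul1r.
Qed.

Lemma gexp_scale es l a f : gexp es l (fun k => a * f k) = a * gexp es l f.
Proof. by elim: es l => [//|e es IH] l; rewrite !gexp_cons !IH; ring. Qed.

Lemma gexpB es l f g : gexp es l (fun k => f k - g k) = gexp es l f - gexp es l g.
Proof. by elim: es l => [//|e es IH] l; rewrite !gexp_cons !IH; ring. Qed.

Hypothesis rho_gt0 : forall e k, 0 < rho e k.

Lemma gexp_gt0 es l f : (forall k, 0 < f k) -> 0 < gexp es l f.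
Proof.
elim: es l f => [|e es IH] l f f0; first exact: f0.
rewrite gexp_cons; have o0 := IH (setb e false l) _ (rho_gt0 e).
have p0 : 0 < prob e es l by rewrite divr_gt0 // addr_gt0.
have p1 : prob e es l < 1 by rewrite ltr_pdivrMr ?mul1r ?ltrDr ?addr_gt0.
by rewrite addr_gt0 // mulr_gt0 ?IH ?subr_gt0.
Qed.

Lemma prob_bounds e es l : 0 < prob e es l < 1.
Proof.
have o0 := gexp_gt0 es (setb e false l) (rho_gt0 e).
by rewrite divr_gt0 ?addr_gt0 //= ltr_pdivrMr ?mul1r ?ltrDr ?addr_gt0.
Qed.

Lemma gexp_le es l f g : (forall k, agree es l k -> f k <= g k) -> gexp es l f <= gexp es l g.
Proof.
elim: es l => [|e es IH] l fg; first by apply: fg.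
have /andP[p0 p1] := prob_bounds e es l.
rewrite !gexp_cons; apply: lerD; apply: ler_wpM2l; rewrite ?subr_ge0 ?(ltW p0) ?(ltW p1) //;
  by apply: IH => k /agree_cons; exact: fg.
Qed.

Lemma eq_gexp es l f g : (forall k, agree es l k -> f k = g k) -> gexp es l f = gexp es l g.
Proof.
by move=> fg; apply/eqP; rewrite eq_le !gexp_le // => k /fg ->.
Qed.

Lemma gexp_local es l l' f : agree es l l' -> gexp es l f = gexp es l' f.
Proof.
elim: es l l' f => [|e es IH] l l' f a.
  by congr (f _); apply/funext => e; rewrite a.
by rewrite !gexp_cons /prob !(IH _ _ _ (agree_setb _ a)).
Qed.

(** The recursion treats [es2] last, and the inner expectation depends only on edges off [es2].
    General sublists are reached later by reordering. *)
Lemma gexp_tower es1 es2 l f :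
  gexp (es1 ++ es2) l f = gexp (es1 ++ es2) l (fun k => gexp es2 k f).
Proof.
elim: es1 l => [|e es1 IH] l /=.
  rewrite -[LHS](gexp_cst es2 l); apply: eq_gexp => k; exact: gexp_local.
by rewrite !IH.
Qed.

(** * The monotone coupling *)

Section Coupling.
Hypothesis rho_mono : forall e k l, lek k l -> rho e k <= rho e l.

(** The three terms are: [e] high in both, high only in the second, low in both. That the middle
    coefficient is nonnegative for ordered boundary conditions is shown inside [gcpl_le]. *)
Fixpoint gcpl es l l' (F : K -> K -> R) : R :=
  if es is e :: es' then
    prob e es' l * gcpl es' (setb e true l) (setb e true l') F +
    (prob e es' l' - prob e es' l) * gcpl es' (setb e false l) (setb e true l') F +
    (1 - prob e es' l') * gcpl es' (setb e false l) (setb e false l') F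
  else F l l'.

Lemma gcpl_fst es l l' f : gcpl es l l' (fun k _ => f k) = gexp es l f.
Proof.
by elim: es l l' => [//|e es IH] l l'; rewrite gexp_cons /= !IH; ring.
Qed.

Lemma gcpl_snd es l l' f : gcpl es l l' (fun _ k => f k) = gexp es l' f.
Proof.
by elim: es l l' => [//|e es IH] l l'; rewrite gexp_cons /= !IH; ring.
Qed.

Lemma gcpl_lin es l l' a F G :
  gcpl es l l' (fun k k' => a * F k k' + G k k') = a * gcpl es l l' F + gcpl es l l' G.
Proof. by elim: es l l' => [//|e es IH] l l' /=; rewrite !IH; ring. Qed.

Lemma gcpl_cst es l l' c : gcpl es l l' (fun _ _ => c) = c.
Proof. by elim: es l l' => [//|e es IH] l l' /=; rewrite !IH; ring. Qed.

Lemma gcpl_scale es l l' a F : gcpl es l l' (fun k k' => a * F k k') = a * gcpl es l l' F.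
Proof. by elim: es l l' => [//|e es IH] l l' /=; rewrite !IH; ring. Qed.

Lemma gcpl_sum (I : Type) (s : seq I) es l l' (F : I -> K -> K -> R) :
  gcpl es l l' (fun k k' => \sum_(i <- s) F i k k') = \sum_(i <- s) gcpl es l l' (F i).
Proof.
have ext F1 F2 : (forall k k', F1 k k' = F2 k k') -> gcpl es l l' F1 = gcpl es l l' F2.
  by move=> h; congr gcpl; apply/funext => k; apply/funext => k'.
elim: s => [|i s IH]; first by rewrite big_nil -[RHS](gcpl_cst es l l'); apply: ext => k k'; rewrite big_nil.
rewrite big_cons -IH -[gcpl es l l' (F i)]mul1r -gcpl_lin; apply: ext => k k'.
by rewrite big_cons mul1r.
Qed.

Lemma gcpl_le es l l' F G : lek l l' ->
  (forall k k', lek k k' -> agree es l k -> agree es l' k' -> F k k' <= G k k') ->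
  gcpl es l l' F <= gcpl es l l' G.
Proof.
elim: es l l' F G => [|e es IH] l l' F G ll' FG; first exact: FG.
have /andP[p0 p1] := prob_bounds e es l; have /andP[p0' p1'] := prob_bounds e es l'.
(* The probabilities of [e] are ordered by the coupling of the remaining edges, with [rho e] as
   increasing observable; hence a single induction. *)
have pp : prob e es l <= prob e es l'.
  have oo : gexp es (setb e false l) (rho e) <= gexp es (setb e false l') (rho e).
    rewrite -(gcpl_fst es _ (setb e false l')) -[X in _ <= X](gcpl_snd es (setb e false l)).
    apply: IH => [|k k' kk' _ _]; [exact: lek_setb|exact: rho_mono].
  have o0 := gexp_gt0 es (setb e false l) (rho_gt0 e).
  have o0' := gexp_gt0 es (setb e false l') (rho_gt0 e).
  rewrite /prob ler_pdivrMr ?addr_gt0 // mulrAC ler_pdivlMr ?addr_gt0 //.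
  by rewrite !mulrDr !mulr1 [X in _ <= _ + X]mulrC lerD2r.
rewrite /=; apply: lerD; first apply: lerD; apply: ler_wpM2l;
  rewrite ?subr_ge0 ?(ltW p0) ?(ltW p1') //; apply: IH;
  by [apply: lek_setb|move=> k k' kk' /agree_cons a /agree_cons a'; exact: FG].
Qed.

Lemma gexp_mono es l l' f : lek l l' -> (forall k k', lek k k' -> f k <= f k') ->
  gexp es l f <= gexp es l' f.
Proof.
move=> ll' fm; rewrite -(gcpl_fst es l l') -(gcpl_snd es l l'); apply: gcpl_le => // k k' kk' _ _.
exact: fm.
Qed.

End Coupling.
End Exp.

(** Applied to translations, where [tau] moves the edges, and to truncation of configurations, where
    [tau] is the identity. *)
Lemma gexp_map (rho rho' : E -> K -> R) (tau : E -> E) (theta : K -> K) es l f :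
  (forall e b k, e \in es -> theta (setb (tau e) b k) = setb e b (theta k)) ->
  (forall e k, e \in es -> rho' (tau e) k = rho e (theta k)) ->
  gexp rho es (theta l) f = gexp rho' (map tau es) l (fun k => f (theta k)).
Proof.
elim: es l f => [//|e es IH] l f ht hr.
have ht' e' b k : e' \in es -> theta (setb (tau e') b k) = setb e' b (theta k).
  by move=> h; apply: ht; rewrite inE h orbT.
have hr' e' k : e' \in es -> rho' (tau e') k = rho e' (theta k).
  by move=> h; apply: hr; rewrite inE h orbT.
have hE : rho' (tau e) = (fun k => rho e (theta k)).
  by apply/funext => k; rewrite hr // mem_head.
by rewrite map_cons !gexp_cons /prob hE -!(ht e) ?mem_head // !IH.
Qed.

Lemma gexp_weight (rho : E -> K -> R) (w : K -> R) es l f : uniq es ->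
  (forall k, 0 < w k) ->
  (forall e k, e \in es -> rho e k = w (setb e true k) / w (setb e false k)) ->
  gexp rho es l f * \sum_(k <- confs es l) w k = \sum_(k <- confs es l) f k * w k.
Proof.
move=> ues w0 rw; elim: es l f ues rw => [|e es IH] l f; first by rewrite /= !big_seq1.
move=> /= /andP[ees ues] rw; rewrite !big_cat /=.
have rw' e' k : e' \in es -> rho e' k = w (setb e' true k) / w (setb e' false k).
  by move=> h; apply: rw; rewrite inE h orbT.
set o := gexp rho es (setb e false l) (rho e).
set Z1 := \sum_(k <- confs es (setb e true l)) w k.
set Z0 := \sum_(k <- confs es (setb e false l)) w k.
have Zgt l' : 0 < \sum_(k <- confs es l') w k.
  rewrite (perm_big _ (perm_to_rem (proj2 (mem_confs es l' l') (@agree_refl es l')))) big_cons.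
  by rewrite ltr_pwDl // sumr_ge0 // => k _; exact: ltW.
(* Raising [e] maps the configurations with [e] low bijectively onto those with [e] high and turns
   [rho e k * w k] into the weight of the image. *)
have oZ : o * Z0 = Z1.
  rewrite /o /Z0 IH // /Z1.
  have -> : \sum_(k <- confs es (setb e false l)) rho e k * w k =
            \sum_(k <- confs es (setb e false l)) w (setb e true k).
    rewrite big_seq [RHS]big_seq; apply: eq_bigr => k /mem_confs /(_ e ees) kl.
    have ke : k e = false by rewrite kl /setb eqxx.
    by rewrite rw ?mem_head // -[in w k](setb_id e k) ke divfK // gt_eqF.
  rewrite -(big_map (setb e true) xpredT); apply: perm_big; apply: uniq_perm.
  - rewrite map_inj_in_uniq ?confs_uniq // => k k' /mem_confs /(_ e ees) h /mem_confs /(_ e ees) h'.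
    move=> kk'; rewrite -[k](setb_id e) -[k'](setb_id e) h h' /setb eqxx.
    apply/funext => g; case: eqP => // /eqP /negbTE ge.
    by have := congr1 (fun z => z g) kk'; rewrite /setb ge.
  - exact: confs_uniq.
  move=> k; apply/mapP/idP => [[k' /mem_confs a ->]|/mem_confs a]; last first.
    exists (setb e false k).
      apply/mem_confs => f' f'es; rewrite /setb; case: eqP => // /eqP /negbTE f'e.
      by rewrite a // /setb f'e.
    by rewrite setb_setb -[LHS](setb_id e) (a e ees) /setb eqxx.
  apply/mem_confs => f' f'es; rewrite /setb; case: eqP => // /eqP /negbTE f'e.
  by rewrite a // /setb f'e.
have o0 : 0 < o.
  rewrite -(pmulr_lgt0 _ (Zgt (setb e false l))) -/Z0 oZ; exact: Zgt.
rewrite -!IH // -/Z1 -/Z0 -oZ; field; rewrite gt_eqF // addr_gt0 //.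
Qed.

Lemma perm_confs es es' l : uniq es -> uniq es' -> es =i es' -> perm_eq (confs es l) (confs es' l).
Proof.
move=> u u' ee'; apply: uniq_perm; rewrite ?confs_uniq // => k.
by apply/idP/idP => /mem_confs a; apply/mem_confs => e; move: (a e); rewrite ee'.
Qed.

Lemma gexp_cvg (rho_ : nat -> E -> K -> R) (rho : E -> K -> R) es l (f_ : nat -> K -> R) f :
  (forall e k, 0 < rho e k) ->
  (forall e k, e \in es -> rho_ n e k @[n --> \oo] --> rho e k) ->
  (forall k, agree es l k -> f_ n k @[n --> \oo] --> f k) ->
  gexp (rho_ n) es l (f_ n) @[n --> \oo] --> gexp rho es l f.
Proof.
move=> r0; elim: es l f_ f => [|e es IH] l f_ f hr hf; first exact: hf.
have hr' e' k : e' \in es -> rho_ n e' k @[n --> \oo] --> rho e' k.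
  by move=> h; apply: hr; rewrite inE h orbT.
have ho : gexp (rho_ n) es (setb e false l) (rho_ n e) @[n --> \oo] -->
    gexp rho es (setb e false l) (rho e).
  by apply: IH => // k _; apply: hr; rewrite mem_head.
have o0 := gexp_gt0 r0 es (setb e false l) (r0 e).
have hp : prob (rho_ n) e es l @[n --> \oo] --> prob rho e es l.
  rewrite /prob; apply: cvgM => //; apply: cvgV; first by rewrite gt_eqF // addr_gt0.
  by apply: cvgD => //; exact: cvg_cst.
have h1 b : gexp (rho_ n) es (setb e b l) (f_ n) @[n --> \oo] --> gexp rho es (setb e b l) f.
  by apply: IH => // k /agree_cons; exact: hf.
rewrite gexp_cons; under eq_fun do rewrite gexp_cons.
apply: cvgD; apply: cvgM => //; apply: cvgB => //; exact: cvg_cst.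
Qed.

End Configurations.

(** * The infinite-volume specification *)

Lemma eq_near_cvg (R : realType) (u v : nat -> R) (a : R) :
  (\forall n \near \oo, u n = v n) -> u n @[n --> \oo] --> a -> v n @[n --> \oo] --> a.
Proof.
by move=> uv; apply: cvg_trans; apply: near_eq_cvg; apply: filterS uv => n ->.
Qed.

Section Specification.
Variables (d : nat) (R : realType) (p q : R).
Hypotheses (p01 : 0 < p < 1) (q1 : 1 <= q).
Implicit Types (N : nat) (e : edge d) (k l : cfg d) (es : seq (edge d)).

Let p0 : 0 < p. Proof. by case/andP: p01. Qed.
Let p1 : 0 < 1 - p. Proof. by rewrite subr_gt0; case/andP: p01. Qed.

Lemma nhigh_nlow N k (a b : R) :
  a ^+ nhigh N k * b ^+ nlow N k = \prod_(e <- edges d N) (if k e then a else b).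
Proof.
rewrite big_map big_enum (bigID (fun vi : box d N * 'I_d => k (emb vi.1, vi.2))) /=.
congr (_ * _).
  rewrite (eq_bigr (fun=> a)) => [|vi /andP[_ ->]//].
  rewrite prodr_const /nhigh; congr (_ ^+ _); apply: eq_card => vi; exact: asboolb.
rewrite (eq_bigr (fun=> b)) => [|vi /andP[_ /negbTE ->]//].
rewrite prodr_const /nlow; congr (_ ^+ _); apply: eq_card => vi; exact: asboolb.
Qed.

Lemma weightE N k : weight p q N k =
  (\prod_(e <- edges d N) (if k e then p else 1 - p)) * (Num.sqrt (detLap q k N))^-1.
Proof. by rewrite /weight nhigh_nlow. Qed.

Lemma weight_gt0 N k : 0 < weight p q N k.
Proof.
rewrite weightE mulr_gt0 ?invr_gt0 ?sqrtr_gt0 ?detLap_gt0 //.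
by apply: prodr_gt0 => e _; case: ifP.
Qed.

Lemma weight_local N k k' : (forall f, in_edges N f -> k f = k' f) ->
  weight p q N k = weight p q N k'.
Proof.
move=> kk'; rewrite !weightE (detLap_local q kk') !big_seq; congr (_ * _).
by apply: eq_bigr => f; rewrite mem_edges => /kk' ->.
Qed.

(** By [detLap_setb], the ratio of the weights with an edge high and low, as a function of its
    resistance when low. *)
Definition odds (r : R) : R := p / (1 - p) / Num.sqrt (1 + (q - 1) * r).

(** The default 0, for the finitely many boxes that miss [e], keeps the bounds 0 and 1 valid for all
    [N]. *)
Definition box_res N e k : R := if in_edges N e then res0 q N k e else 0.

Lemma box_res_bounds N e k : 0 <= box_res N e k <= 1.
Proof. by rewrite /box_res; case: ifP => [/(res0_bounds q1)//|_]; rewrite lexx ler01. Qed.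

Definition lim_res e k : R := limn (fun N => box_res N e k).

Lemma box_res_le N M e k k' : in_edges N e -> (N <= M)%N ->
  (forall f, in_edges N f -> k f -> k' f) -> box_res M e k' <= box_res N e k.
Proof.
move=> eN NM kk'; rewrite /box_res eN (in_edges_le NM eN).
apply: res_le => // f fN; rewrite /setb; case: eqP => // _; exact: kk'.
Qed.

Lemma box_res_cvg e k : box_res N e k @[N --> \oo] --> lim_res e k.
Proof.
have [N0 eN] := in_box_exists e.
suff : cvgn (fun N => box_res (N + N0) e k).
  move/cvg_ex => [l hl]; have hl' : box_res N e k @[N --> \oo] --> l.
    by rewrite -(cvg_shiftn N0 (fun N => box_res N e k)).
  by rewrite /lim_res (cvg_lim _ hl').
apply: nonincreasing_is_cvgn; last by exists 0 => _ [N _ <-]; case/andP: (box_res_bounds (N + N0) e k).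
by move=> N M NM; apply: box_res_le => //; [apply: in_edges_le eN; rewrite leq_addl|rewrite leq_add2r].
Qed.

Lemma lim_res_le N e k : in_edges N e -> lim_res e k <= box_res N e k.
Proof.
move=> eN; apply: limr_le; first by apply/cvg_ex; exists (lim_res e k); exact: box_res_cvg.
by exists N => // M /= NM; exact: box_res_le.
Qed.

Lemma lim_res_ge0 e k : 0 <= lim_res e k.
Proof.
apply: limr_ge; first by apply/cvg_ex; exists (lim_res e k); exact: box_res_cvg.
by apply: nearW => N; case/andP: (box_res_bounds N e k).
Qed.

Lemma box_res_mono N e k k' : lek k k' -> box_res N e k' <= box_res N e k.
Proof.
move=> kk'; case eN : (in_edges N e); last by rewrite /box_res eN.
by apply: box_res_le => // f _; exact: kk'.
Qed.

Lemma lim_res_mono e k k' : lek k k' -> lim_res e k' <= lim_res e k.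
Proof.
move=> kk'; apply: ler_lim.
- by apply/cvg_ex; exists (lim_res e k'); exact: box_res_cvg.
- by apply/cvg_ex; exists (lim_res e k); exact: box_res_cvg.
- by apply: nearW => N; exact: box_res_mono.
Qed.

Lemma lim_res_tr_le x e k : lim_res (tr x e) k <= lim_res e (k \o tr x).
Proof.
have [M0 /andP[xM _]] := in_box_exists (x, e.2).
rewrite [X in _ <= X]/lim_res; apply: limr_ge.
  by apply/cvg_ex; exists (lim_res e (k \o tr x)); exact: box_res_cvg.
have [N0 eN0] := in_box_exists e; exists N0 => // N /= NN0.
have eN := in_edges_le NN0 eN0.
apply: (le_trans (lim_res_le k (in_edges_tr xM eN))).
rewrite /box_res eN (in_edges_tr xM eN) /res0; apply: le_trans (res_tr q1 _ xM eN) _.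
by apply: res_le => // f _; rewrite /setb /= (inj_eq (@tr_inj _ x)).
Qed.

(** Finite boxes give only an inequality; applying it to [x] and to its opposite gives equality in
    the limit. *)
Lemma lim_res_tr x e k : lim_res (tr x e) k = lim_res e (k \o tr x).
Proof.
apply/eqP; rewrite eq_le; apply/andP; split; first exact: lim_res_tr_le.
pose y : site d := [ffun j => - x j].
have trK f : tr y (tr x f) = f.
  by case: f => f i; congr (_, _); apply/ffunP => j; rewrite !ffunE /= addrK.
have trK' f : tr x (tr y f) = f.
  by case: f => f i; congr (_, _); apply/ffunP => j; rewrite !ffunE /= subrK.
have := lim_res_tr_le y (tr x e) (k \o tr x); rewrite trK.
by congr (_ <= lim_res _ _); apply/funext => f /=; rewrite trK'.
Qed.

(** Being bounded above by its local box values, the limit is upper semicontinuous; approach from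
    below supplies the opposite bound by monotonicity. *)
Lemma lim_res_left (k_ : nat -> cfg d) k e : (forall n, lek (k_ n) k) ->
  (forall N, \forall n \near \oo, forall f, in_edges N f -> k_ n f = k f) ->
  lim_res e (k_ n) @[n --> \oo] --> lim_res e k.
Proof.
move=> kn kN; apply/cvgrPdist_le => eps eps0.
have [N0 eN0] := in_box_exists e.
have /cvgrPdist_le/(_ eps eps0) [N1 _ hN1] := @box_res_cvg e k.
pose N := maxn N0 N1; have eN : in_edges N e by apply: in_edges_le eN0; rewrite leq_maxl.
have rk : `|lim_res e k - box_res N e k| <= eps := hN1 N (leq_maxr _ _).
move: rk; rewrite ler_norml => /andP[rk _].
apply: filterS (kN N) => n knN; have h1 := lim_res_mono e (kn n).
rewrite distrC ger0_norm ?subr_ge0 //=.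
suff : lim_res e (k_ n) <= box_res N e k.
  by move: rk; move: (lim_res e k) (box_res N e k) (lim_res e (k_ n)) => a b c; lra.
by apply: le_trans (lim_res_le (k_ n) eN) _; apply: box_res_le => // f fN; rewrite knN.
Qed.

Lemma sqrt_ge1 (r : R) : 0 <= r -> 1 <= Num.sqrt (1 + (q - 1) * r).
Proof.
move=> r0; rewrite -[X in X <= _]sqrtr1 ler_sqrt ?lerDl ?mulr_ge0 ?subr_ge0 //.
by rewrite addr_ge0 ?mulr_ge0 ?subr_ge0.
Qed.

Lemma odds_gt0 (r : R) : 0 <= r -> 0 < odds r.
Proof.
by move=> r0; rewrite !divr_gt0 //; apply: lt_le_trans (sqrt_ge1 r0).
Qed.

Lemma odds_mono (r r' : R) : 0 <= r -> r <= r' -> odds r' <= odds r.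
Proof.
move=> r0 rr'; have r'0 := le_trans r0 rr'.
rewrite /odds ler_wpM2l ?(ltW (divr_gt0 _ _)) // lef_pV2 ?posrE; last 2 first.
- exact: lt_le_trans (sqrt_ge1 r'0).
- exact: lt_le_trans (sqrt_ge1 r0).
by rewrite ler_sqrt ?lerD2l ?ler_wpM2l ?subr_ge0 // addr_ge0 ?mulr_ge0 ?subr_ge0.
Qed.

Lemma odds_cvg (r_ : nat -> R) (r : R) : 0 <= r -> r_ n @[n --> \oo] --> r ->
  odds (r_ n) @[n --> \oo] --> odds r.
Proof.
move=> r0 hr; apply: cvgM; first exact: cvg_cst.
apply: cvgV; first by rewrite gt_eqF //; apply: lt_le_trans (sqrt_ge1 r0).
apply: continuous_cvg; first exact: sqrt_continuous.
apply: cvgD; first exact: cvg_cst.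
by apply: cvgM => //; exact: cvg_cst.
Qed.

Definition rho e k : R := odds (lim_res e k).
Definition rhoN N e k : R := odds (box_res N e k).

Lemma rhoN_gt0 N e k : 0 < rhoN N e k.
Proof. by apply: odds_gt0; case/andP: (box_res_bounds N e k). Qed.

Lemma rho_gt0 e k : 0 < rho e k.
Proof. by apply: odds_gt0; exact: lim_res_ge0. Qed.

Lemma rhoN_mono N e k l : lek k l -> rhoN N e k <= rhoN N e l.
Proof. by move=> kl; apply: odds_mono; [case/andP: (box_res_bounds N e l)|exact: box_res_mono]. Qed.

Lemma rho_mono e k l : lek k l -> rho e k <= rho e l.
Proof. by move=> kl; apply: odds_mono; [exact: lim_res_ge0|exact: lim_res_mono]. Qed.

Lemma rhoN_cvg e k : rhoN N e k @[N --> \oo] --> rho e k.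
Proof. by apply: odds_cvg; [exact: lim_res_ge0|exact: box_res_cvg]. Qed.

Lemma rhoN_weight N e k : in_edges N e ->
  rhoN N e k = weight p q N (setb e true k) / weight p q N (setb e false k).
Proof.
move=> eN; rewrite !weightE (detLap_setb q1 _ eN) /rhoN /box_res eN -/(res0 q N k e).
have /andP[r0 _] := res0_bounds q1 k eN.
have eE : e \in edges d N by rewrite mem_edges.
have prodE b : \prod_(f <- edges d N) (if setb e b k f then p else 1 - p) =
   (if b then p else 1 - p) * \prod_(f <- rem e (edges d N)) (if k f then p else 1 - p).
  rewrite (perm_big _ (perm_to_rem eE)) big_cons /setb eqxx; congr (_ * _).
  rewrite !big_seq; apply: eq_bigr => f; rewrite mem_rem_uniq ?edges_uniq // inE.
  by case/andP => /negbTE ->.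
rewrite !prodE; set P := \prod_(f <- _) _.
have P0 : P != 0 by rewrite gt_eqF //; apply: prodr_gt0 => f _; case: ifP.
have D0 : 0 < detLap q (setb e false k) N by apply: detLap_gt0.
rewrite sqrtrM ?(ltW D0) // /odds.
have S0 : Num.sqrt (detLap q (setb e false k) N) != 0 by rewrite gt_eqF // sqrtr_gt0.
have T0 : Num.sqrt (1 + (q - 1) * res0 q N k e) != 0.
  by rewrite gt_eqF //; apply: lt_le_trans (sqrt_ge1 r0).
by field; rewrite T0 S0 P0 gt_eqF.
Qed.

Lemma gexpN_weight N es l (f : cfg d -> R) : uniq es -> {subset es <= edges d N} ->
  gexp (rhoN N) es l f * \sum_(k <- confs es l) weight p q N k =
  \sum_(k <- confs es l) f k * weight p q N k.
Proof.
move=> ues esN; apply: gexp_weight => // [k|e k ees]; first exact: weight_gt0.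
by rewrite rhoN_weight // -mem_edges esN.
Qed.

Lemma sum_weight_gt0 N es l : 0 < \sum_(k <- confs es l) weight p q N k.
Proof.
rewrite (perm_big _ (perm_to_rem (proj2 (mem_confs es l l) (@agree_refl _ es l)))) big_cons.
by rewrite ltr_pwDl ?weight_gt0 // sumr_ge0 // => k _; exact: ltW (weight_gt0 _ _).
Qed.

Lemma gexpN_perm N es es' l (f : cfg d -> R) : uniq es -> uniq es' -> es =i es' ->
  {subset es <= edges d N} -> gexp (rhoN N) es l f = gexp (rhoN N) es' l f.
Proof.
move=> u u' ee' esN; apply: (mulIf (lt0r_neq0 (sum_weight_gt0 N es l))).
rewrite gexpN_weight // (perm_big _ (perm_confs l u u' ee')).
rewrite [in RHS](perm_big _ (perm_confs l u u' ee')) gexpN_weight // => e.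
by rewrite -ee' => /esN.
Qed.

Lemma gexp_rho_cvg es l (f_ : nat -> cfg d -> R) f :
  (forall k, agree es l k -> f_ N k @[N --> \oo] --> f k) ->
  gexp (rhoN N) es l (f_ N) @[N --> \oo] --> gexp rho es l f.
Proof.
move=> hf; apply: gexp_cvg => //; first by move=> e k; exact: rho_gt0.
by move=> e k _; exact: rhoN_cvg.
Qed.

Lemma gexp_rho_cvg0 es l (f : cfg d -> R) :
  gexp (rhoN N) es l f @[N --> \oo] --> gexp rho es l f.
Proof. by apply: gexp_rho_cvg => k _; exact: cvg_cst. Qed.

Lemma subset_edges es : \forall N \near \oo, {subset es <= edges d N}.
Proof.
elim: es => [|e es IH]; first by apply: nearW.
have [N0 eN0] := in_box_exists e; near=> N => f; rewrite inE => /orP[/eqP ->|].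
  by rewrite mem_edges; apply: in_edges_le eN0; near: N; exact: nbhs_infty_ge.
by move: f; near: N.
Unshelve. all: by end_near. Qed.

(** In a box both orders compute the same normalised sum of weights. The infinite-volume odds come
    from no weight, so independence of the order is inherited through the limit. *)
Lemma gexp_rho_perm es es' l (f : cfg d -> R) : uniq es -> uniq es' -> es =i es' ->
  gexp rho es l f = gexp rho es' l f.
Proof.
move=> u u' ee'.
have h : gexp (rhoN N) es l f @[N --> \oo] --> gexp rho es' l f.
  have := @gexp_rho_cvg0 es' l f.
  apply: eq_near_cvg; apply: filterS (subset_edges es) => N esN.
  exact: esym (gexpN_perm _ _ u u' ee' esN).
by apply: (cvg_unique _ _ h) => //; exact: gexp_rho_cvg0.
Qed.

Lemma perm_confs_upd (B : {fset edge d}) l :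
  perm_eq (confs (enum_fset B) l) [seq upd l t | t : {ffun B -> bool}].
Proof.
apply: uniq_perm; first by apply: confs_uniq; exact: fset_uniq.
  rewrite map_inj_uniq ?enum_uniq // => t t' tt'; apply/ffunP => e.
  by have := congr1 (fun k => k (fsval e)) tt'; rewrite /upd valK.
move=> k; apply/idP/mapP => [/mem_confs a|[t _ ->]].
  exists [ffun e : B => k (fsval e)]; first by rewrite mem_enum.
  apply/funext => e; rewrite /upd; case: insubP => [e' eB ee'|eB]; last by rewrite a.
  by rewrite ffunE -ee'.
by apply/mem_confs => e eB; rewrite /upd insubN.
Qed.

Lemma sum_upd (B : {fset edge d}) l (F : cfg d -> R) :
  \sum_(t : {ffun B -> bool}) F (upd l t) = \sum_(k <- confs (enum_fset B) l) F k.
Proof. by rewrite (perm_big _ (perm_confs_upd B l)) big_map big_enum. Qed.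

Lemma upd_agree (B : {fset edge d}) l (t : {ffun B -> bool}) : agree (enum_fset B) l (upd l t).
Proof. by move=> e eB; rewrite /upd insubN. Qed.

Lemma gammaN_gexp N (B : {fset edge d}) l (t : {ffun B -> bool}) :
  {subset enum_fset B <= edges d N} ->
  gammaN p q N B (upd l t) l = gexp (rhoN N) (enum_fset B) l (fun k => (k == upd l t)%:R).
Proof.
move=> BN; apply: (mulIf (lt0r_neq0 (sum_weight_gt0 N (enum_fset B) l))).
rewrite gexpN_weight ?fset_uniq // /gammaN (sum_upd B l (weight p q N)).
rewrite divfK ?(gt_eqF (sum_weight_gt0 _ _ _)) // asboolT; last exact: upd_agree.
rewrite mul1r -(sum_upd B l (fun k => (k == upd l t)%:R * weight p q N k)).
rewrite (bigD1 t) //= eqxx mul1r big1 ?addr0 // => t' t't.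
case: eqP => [h|_]; last by rewrite mul0r.
case/eqP: t't; apply/ffunP => e.
by have := congr1 (fun k => k (fsval e)) h; rewrite /upd valK.
Qed.

Lemma gamma_gexp (B : {fset edge d}) l (t : {ffun B -> bool}) :
  gamma p q B (upd l t) l = gexp rho (enum_fset B) l (fun k => (k == upd l t)%:R).
Proof.
apply/cvg_lim => //.
have := @gexp_rho_cvg0 (enum_fset B) l (fun k => (k == upd l t)%:R).
apply: eq_near_cvg; apply: filterS (subset_edges (enum_fset B)) => N BN.
exact/esym/gammaN_gexp.
Qed.

Lemma gammaN_cvg (B : {fset edge d}) l (t : {ffun B -> bool}) :
  gammaN p q N B (upd l t) l @[N --> \oo] --> gamma p q B (upd l t) l.
Proof.
rewrite gamma_gexp.
have := @gexp_rho_cvg0 (enum_fset B) l (fun k => (k == upd l t)%:R).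
apply: eq_near_cvg; apply: filterS (subset_edges (enum_fset B)) => N BN.
exact/esym/gammaN_gexp.
Qed.

Lemma gammaA_gexp (B : {fset edge d}) (A : set (cfg d)) l :
  gammaA p q B A l = gexp rho (enum_fset B) l (\1_A).
Proof.
rewrite /gammaA (eq_bigr (fun t => gexp rho (enum_fset B) l
    (fun k => (if `[< A (upd l t) >] then 1 else 0) * (k == upd l t)%:R))); last first.
  by move=> t _; rewrite gexp_scale gamma_gexp.
rewrite -gexp_sum; apply: eq_gexp => [e k|k a]; first exact: rho_gt0.
have : k \in confs (enum_fset B) l by apply/mem_confs.
rewrite (perm_mem (perm_confs_upd B l)) => /mapP [t _ ->].
rewrite (bigD1 t) //= eqxx mulr1 big1 ?addr0 => [|t' t't]; last first.
  case: eqP => [h|_]; last by rewrite mulr0.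
  case/eqP: t't; apply/ffunP => e.
  by have := congr1 (fun k => k (fsval e)) h; rewrite /upd valK.
by rewrite indicE; case: asboolP => h; [rewrite mem_set|rewrite memNset].
Qed.

End Specification.

(** * Decay of discrepancies *)

Section Uniqueness.
Variables (d : nat) (R : realType) (p q : R).
Hypotheses (p01 : 0 < p < 1) (q1 : 1 <= q) (d0 : (0 < d)%N).
Hypothesis small : p * (1 - p) * (q - 1) ^+ 2 * q ^+ 2 <= 1.
Implicit Types (N : nat) (e : edge d) (k l : cfg d) (es : seq (edge d)).

Let p0 : 0 < p. Proof. by case/andP: p01. Qed.
Let p1 : 0 < 1 - p. Proof. by rewrite subr_gt0; case/andP: p01. Qed.

Local Notation rho := (rho p q).
Local Notation rhoN := (rhoN p q).
Local Notation odds := (odds p q).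

Definition occ e k : R := (k e)%:R.
(** The conditional probability that an edge is high given all others, as a function of its
    resistance when low. *)
Definition site_prob (r : R) : R := odds r / (1 + odds r).

Lemma site_probE r : 0 <= r -> site_prob r = p / (p + (1 - p) * Num.sqrt (1 + (q - 1) * r)).
Proof.
move=> r0; have s1 := sqrt_ge1 q1 r0; rewrite /site_prob /odds.
set s := Num.sqrt _ in s1 *.
have s0 : s != 0 by rewrite gt_eqF //; lra.
have h0 : p + (1 - p) * s != 0 by rewrite gt_eqF // addr_gt0 // mulr_gt0 //; lra.
by field; rewrite h0 s0 gt_eqF.
Qed.

(** The square roots are at least 1, so their difference is at most [(q - 1) / 2] times that of the
    resistances; the denominators in [site_probE] are at least 1. *)
Lemma site_prob_lipschitz r r' : 0 <= r -> r <= r' ->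
  site_prob r - site_prob r' <= p * (1 - p) * (q - 1) / 2 * (r' - r).
Proof.
move=> r0 rr'; have r'0 := le_trans r0 rr'; rewrite !site_probE //.
have s1 := sqrt_ge1 q1 r0; have s1' := sqrt_ge1 q1 r'0.
have q0 : 0 <= q - 1 by rewrite subr_ge0.
have sq t : 0 <= t -> Num.sqrt (1 + (q - 1) * t) ^+ 2 = 1 + (q - 1) * t.
  by move=> t0; rewrite sqr_sqrtr // addr_ge0 // mulr_ge0.
have := sq r r0; have := sq r' r'0.
set a := Num.sqrt (1 + (q - 1) * r) in s1 *; set b := Num.sqrt _ in s1' * => hb ha.
have ab : a <= b by rewrite -ler_sqr ?nnegrE ?(le_trans ler01) // ha hb lerD2l ler_wpM2l.
have ba : b - a <= (q - 1) / 2 * (r' - r).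
  have e1 : (b - a) * (b + a) = (q - 1) * (r' - r) by rewrite -subr_sqr hb ha; ring.
  have b2 : 2 <= b + a by lra.
  have ba0 : 0 <= b - a by rewrite subr_ge0.
  have := ler_wpM2l ba0 b2; rewrite e1; lra.
have A1 : 1 <= p + (1 - p) * a by have := ler_wpM2l (ltW p1) s1; lra.
have B1 : 1 <= p + (1 - p) * b by have := ler_wpM2l (ltW p1) s1'; lra.
have -> : p / (p + (1 - p) * a) - p / (p + (1 - p) * b) =
   p * (1 - p) * (b - a) / ((p + (1 - p) * a) * (p + (1 - p) * b)).
  by field; rewrite !gt_eqF //; apply: lt_le_trans ltr01 _.
have AB : 1 <= (p + (1 - p) * a) * (p + (1 - p) * b).
  by rewrite -[X in X <= _]mulr1 ler_pM.
have pp : 0 <= p * (1 - p) by rewrite mulr_ge0 ?ltW.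
have n0 : 0 <= p * (1 - p) * (b - a) by rewrite mulr_ge0 // subr_ge0.
rewrite ler_pdivrMr; last exact: lt_le_trans ltr01 AB.
apply: (@le_trans _ _ (p * (1 - p) * (q - 1) / 2 * (r' - r))).
  have := ler_wpM2l pp ba; lra.
by rewrite ler_peMr // mulr_ge0 ?subr_ge0 // divr_ge0 // mulr_ge0.
Qed.

(** Moving [e] to the end of the list exhibits its conditional probability given all other edges. *)
Lemma gexpN_occ N es l e : uniq es -> e \in es -> {subset es <= edges d N} ->
  gexp (rhoN N) es l (occ e) = gexp (rhoN N) es l (fun k => site_prob (box_res q N e k)).
Proof.
move=> ues ees esN; pose es' := rem e es ++ [:: e].
have pe : perm_eq es es' by rewrite /es' cats1 perm_sym perm_rcons perm_sym perm_to_rem.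
have ues' : uniq es' by rewrite -(perm_uniq pe).
have P f : gexp (rhoN N) es l f = gexp (rhoN N) es' l f.
  by apply: gexpN_perm => //; exact: perm_mem.
rewrite !P gexp_tower; last by move=> ? ?; exact: rhoN_gt0.
congr gexp; apply/funext => k; rewrite gexp_cons /= /occ /setb eqxx mulr1 mulr0 addr0.
by rewrite /prob /= /rhoN /site_prob /box_res /res0 !setb_setb.
Qed.

Definition bdry n : R := #|{: box d n.+1}|%:R - #|{: box d n}|%:R.

Definition czero : cfg d := fun=> false.
Definition cone : cfg d := fun=> true.

(** Under one coupling, [S] is both the mean number of discrepancies and the mean total difference
    of conditional probabilities. The resistance bounds turn the second into a multiple of the first
    plus a boundary term. *)
Lemma sum_gapN N n : (n < N)%N ->
  \sum_(e <- edges d n.+1) (gexp (rhoN N) (edges d n.+1) cone (occ e) -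
                           gexp (rhoN N) (edges d n.+1) czero (occ e)) <=
  p * (1 - p) * (q - 1) * q ^+ 2 * bdry n.
Proof.
move=> nN; set es := edges d n.+1; set S := \sum_(e <- es) _.
have esN : {subset es <= edges d N}.
  by move=> e; rewrite !mem_edges; exact: in_edges_le.
have r0 e k : 0 < rhoN N e k by exact: rhoN_gt0.
have rm e k l : lek k l -> rhoN N e k <= rhoN N e l by exact: rhoN_mono.
pose C F := gcpl (rhoN N) es czero cone F.
have diff f : gexp (rhoN N) es cone f - gexp (rhoN N) es czero f = C (fun k k' => f k' - f k).
  rewrite /C -(gcpl_snd _ es czero) -(gcpl_fst _ es _ cone) addrC -mulN1r -gcpl_lin.
  by congr gcpl; apply/funext => k; apply/funext => k'; ring.
have S1 : S = C (fun k k' => \sum_(e <- es) (occ e k' - occ e k)).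
  by rewrite /C gcpl_sum; apply: eq_bigr => e _; exact: diff.
have S2 : S = C (fun k k' => \sum_(e <- es) (site_prob (box_res q N e k') - site_prob (box_res q N e k))).
  rewrite /C gcpl_sum /S big_seq [RHS]big_seq; apply: eq_bigr => e ees.
  by rewrite !(gexpN_occ _ _ ees) ?edges_uniq // diff.
set L := p * (1 - p) * (q - 1) / 2.
have L0 : 0 <= L by rewrite divr_ge0 // mulr_ge0 ?subr_ge0 // mulr_ge0 ?ltW.
have : S <= C (fun k k' => L * ((q - 1) * q ^+ 2) * (\sum_(e <- es) (occ e k' - occ e k)) +
                           L * (q ^+ 2 * bdry n)).
  rewrite S2; apply: gcpl_le => // k k' kk' _ _.
  apply: (@le_trans _ _ (\sum_(e <- es) L * (res0 q N k e - res0 q N k' e))).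
    rewrite big_seq [X in _ <= X]big_seq; apply: ler_sum => e ees.
    have eN : in_edges N e by rewrite -mem_edges esN.
    have := box_res_le q1 eN (leqnn N) (fun f _ => kk' f).
    have /andP[h _] := box_res_bounds q1 N e k'.
    by move=> /(site_prob_lipschitz h); rewrite /box_res eN.
  rewrite -mulr_sumr -[X in _ <= X + _]mulrA -mulrDr; apply: ler_wpM2l => //.
  apply: le_trans (sum_res0_diff q1 d0 nN kk') _; rewrite -/es lerD2r.
  rewrite le_eqVlt; apply/orP; left; apply/eqP; congr (_ * _); apply: eq_bigr => f _.
  by rewrite /occ; have := kk' f; case: (k f) => [/(_ isT) ->|_]; case: (k' f) => //=; rewrite ?subrr ?subr0.
rewrite /C gcpl_lin gcpl_cst -/(C _) -S1 => hS.
have S0 : 0 <= S.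
  rewrite S1 -[X in X <= _](gcpl_cst (rhoN N) es czero cone); apply: gcpl_le => // k k' kk' _ _.
  by apply: sumr_ge0 => e _; rewrite subr_ge0 ler_nat /occ; have := kk' e; case: (k e) => // /(_ isT) ->.
(* Hypothesis [small] enters here: at most half of [S] returns on the right, so [S] is at most twice
   [L * (q ^+ 2 * bdry n)]. *)
have half : L * ((q - 1) * q ^+ 2) <= 1 / 2.
  by move: small; rewrite /L; set x := q ^+ 2; rewrite expr2; lra.
have := ler_wpM2r S0 half; move: hS; rewrite /L; set x := q ^+ 2; set y := bdry n.
set z := p * (1 - p) / 2 * (q - 1) * ((q - 1) * x) * S; lra.
Qed.

Definition gap es e : R := gexp rho es cone (occ e) - gexp rho es czero (occ e).

Lemma sum_gap n : \sum_(e <- edges d n.+1) gap (edges d n.+1) e <=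
  p * (1 - p) * (q - 1) * q ^+ 2 * bdry n.
Proof.
have h : \sum_(e <- edges d n.+1) (gexp (rhoN N) (edges d n.+1) cone (occ e) -
      gexp (rhoN N) (edges d n.+1) czero (occ e)) @[N --> \oo] -->
    \sum_(e <- edges d n.+1) gap (edges d n.+1) e.
  elim: {1 4}(edges d n.+1) => [|e es IH].
    by rewrite big_nil; under eq_fun do rewrite big_nil; exact: cvg_cst.
  rewrite big_cons; under eq_fun do rewrite big_cons.
  by apply: cvgD => //; apply: cvgB; exact: gexp_rho_cvg0.
rewrite -(cvg_lim _ h) //; apply: limr_le; first by apply/cvg_ex; eexists; exact: h.
by exists n.+1 => // N /= nN; exact: sum_gapN.
Qed.

Lemma occ_mono e k k' : lek k k' -> occ e k <= occ e k'.
Proof. by move=> kk'; rewrite ler_nat; have := kk' e; case: (k e) => // /(_ isT) ->. Qed.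

Lemma gexp_rho_mono es l l' (f : cfg d -> R) : lek l l' ->
  (forall k k', lek k k' -> f k <= f k') -> gexp rho es l f <= gexp rho es l' f.
Proof.
have r0 e k : 0 < rho e k by exact: (rho_gt0 p01 q1).
have rm e k k' : lek k k' -> rho e k <= rho e k' by exact: (rho_mono p01 q1).
exact: (gexp_mono r0 rm).
Qed.

Lemma gap_ge0 es e : 0 <= gap es e.
Proof.
by rewrite subr_ge0; apply: gexp_rho_mono => // k k'; exact: occ_mono.
Qed.

Lemma gexp_tower_sub es es' l (f : cfg d -> R) : uniq es -> uniq es' -> {subset es <= es'} ->
  gexp rho es' l f = gexp rho es' l (fun k => gexp rho es k f).
Proof.
move=> u u' sub; pose t := [seq e <- es' | e \notin es] ++ es.
have ut : uniq t.
  rewrite cat_uniq filter_uniq // u andbT; apply/hasPn => e ees.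
  by rewrite mem_filter ees.
have te : es' =i t.
  move=> e; rewrite mem_cat mem_filter; case ees : (e \in es) => /=; last by rewrite orbF.
  by rewrite (sub e ees).
have rg e k : 0 < rho e k by exact: (rho_gt0 p01 q1).
by rewrite !(gexp_rho_perm p01 q1 _ _ u' ut te) (gexp_tower rg).
Qed.

Lemma gexp_between es l (f : cfg d -> R) : (forall k k', lek k k' -> f k <= f k') ->
  gexp rho es czero f <= gexp rho es l f <= gexp rho es cone f.
Proof.
by move=> fm; rewrite !gexp_rho_mono.
Qed.

(** Within the larger region the smaller one sees a random boundary condition, squeezed between all
    low and all high. *)
Lemma gap_le es es' e : uniq es -> uniq es' -> {subset es <= es'} -> gap es' e <= gap es e.
Proof.
move=> u u' sub; rewrite /gap (gexp_tower_sub cone (occ e) u u' sub) (gexp_tower_sub czero (occ e) u u' sub).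
have b k := @gexp_between es k (occ e) (@occ_mono e).
have rg e' k : 0 < rho e' k by exact: (rho_gt0 p01 q1).
apply: lerB.
  rewrite -[X in _ <= X](gexp_cst rho es' cone); apply: (gexp_le rg) => k _; by case/andP: (b k).
rewrite -[X in X <= _](gexp_cst rho es' czero); apply: (gexp_le rg) => k _; by case/andP: (b k).
Qed.

Lemma gap_tr x es e : gap (map (tr x) es) (tr x e) = gap es e.
Proof.
have E l : gexp rho (map (tr x) es) l (occ (tr x e)) = gexp rho es (l \o tr x) (occ e).
  symmetry; apply: (@gexp_map _ _ rho rho (tr x) (fun k => k \o tr x)).
    by move=> f b k _; apply/funext => g; rewrite /setb /= (inj_eq (@tr_inj _ x)).
  by move=> f k _; rewrite /rho lim_res_tr.
by rewrite /gap !E.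
Qed.

Lemma cvg_bdry : bdry n / #|{: box d n}|%:R @[n --> \oo] --> (0 : R).
Proof.
have cardE n : #|{: box d n}|%:R = ((2 * n + 1)%:R : R) ^+ d.
  by rewrite card_ffun !card_ord natrX.
have -> : (fun n => bdry n / #|{: box d n}|%:R) = (fun n => (1 + 2 / (2 * n%:R + 1)) ^+ d - 1).
  apply/funext => n; rewrite /bdry !cardE mulrBl divff; last first.
    by rewrite expf_neq0 // pnatr_eq0 addn1.
  have -> : (2 * n.+1 + 1)%:R = 2 * n%:R + 3 :> R by rewrite -natrM -natrD; congr _%:R; lia.
  have -> : (2 * n + 1)%:R = 2 * n%:R + 1 :> R by rewrite addn1 -natr1 natrM.
  rewrite -expr_div_n; congr (_ ^+ _ - _).
  by field; rewrite gt_eqF // ltr_wpDl // mulr_ge0.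
rewrite -[X in _ --> X](subrr (1 : R)); apply: cvgB; last exact: cvg_cst.
have h : 1 + 2 / (2 * n%:R + 1) @[n --> \oo] --> (1 : R).
  rewrite -[X in _ --> X]addr0; apply: cvgD; first exact: cvg_cst.
  apply: (@squeeze_cvgr _ _ _ _ (fun=> 0) (fun n => n.+1%:R^-1 * 2)); last 2 first.
  - exact: cvg_cst.
  - rewrite -[X in _ --> X](mul0r (2 : R)); apply: cvgM; last exact: cvg_cst.
    exact: cvg_harmonic.
  apply: nearW => n; have n0 : (0 : R) <= n%:R by [].
  rewrite divr_ge0 ?addr_ge0 ?mulr_ge0 //= mulrC ler_wpM2r // lef_pV2 ?posrE.
  - by rewrite -natr1; lra.
  - lra.
  - by [].
elim: {cardE} d => [|d' IH]; first exact: cvg_cst.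
have h2 : (1 + 2 / (2 * n%:R + 1)) * (1 + 2 / (2 * n%:R + 1)) ^+ d' @[n --> \oo] --> (1 * 1 : R).
  by apply: cvgM.
by rewrite mulr1 in h2; apply: eq_near_cvg h2; apply: nearW => n; rewrite exprS.
Qed.

(** Averaging over positions: in a large box the gap at [e] is at most the gap in box [n.+1] at
    every parallel edge starting in box [n]. The sum of these is of boundary order, and there are as
    many as sites in box [n]. *)
Lemma gap_cvg e : gap (edges d m) e @[m --> \oo] --> (0 : R).
Proof.
set C := p * (1 - p) * (q - 1) * q ^+ 2.
have bound n : exists M, forall m, (M <= m)%N ->
    gap (edges d m) e <= C * (bdry n / #|{: box d n}|%:R).
  case: e => y i; have [M0 /andP[yM _]] := in_box_exists (y, i).
  (* Translations carrying a site of box [n] to [y] move each coordinate by at most [M0 + n], so all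
     translates of box [n.+1] fit in box [m]. *)
  exists (n.+1 + (M0 + n))%N => m Mm.
  have B0 : (0 : R) < #|{: box d n}|%:R by rewrite ltr0n card_box_gt0.
  rewrite mulrA ler_pdivlMr //; apply: le_trans (sum_gap n).
  have h (v : box d n) : gap (edges d m) (y, i) <= gap (edges d n.+1) (emb v, i).
    pose x : site d := [ffun j => y j - emb v j].
    have -> : (y, i) = tr x (emb v, i).
      by congr (_, _); apply/ffunP => j; rewrite !ffunE /= addrC subrK.
    rewrite -(gap_tr x (edges d n.+1)); apply: gap_le; rewrite ?edges_uniq //.
      by rewrite map_inj_uniq ?edges_uniq //; exact: tr_inj.
    move=> f /mapP [g gE ->]; rewrite mem_edges; apply: (in_edges_le Mm).
    apply: in_edges_tr; last by rewrite -mem_edges.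
    apply/forallP => j; rewrite ffunE; have := forallP yM j; have := forallP (in_box_emb v) j.
    by move: (emb v j) => z /=; move: (y j) => t; lia.
  apply: (@le_trans _ _ (\sum_(v : box d n) gap (edges d n.+1) (emb v, i))).
    by rewrite -mulr_natr -sumr_const -[X in _ * X]natr1 || rewrite mulr_natr -sumr_const; exact: ler_sum.
  have -> : \sum_(v : box d n) gap (edges d n.+1) (emb v, i) =
     \sum_(f <- [seq (emb v, i) | v <- enum {: box d n}]) gap (edges d n.+1) f.
    by rewrite big_map big_enum.
  apply: ler_sum_uniq; rewrite ?edges_uniq //.
  - by rewrite map_inj_uniq ?enum_uniq // => v w [/emb_inj].
  - move=> f /mapP[v _ ->]; rewrite mem_edges /in_edges /=.
    by rewrite (in_box_le (leqnSn n) (in_box_emb v)) (in_box_shift _ (ltnSn n) (in_box_emb v)).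
  - by move=> f; exact: gap_ge0.
apply/cvgrPdist_le => eps eps0.
have : C * (bdry n / #|{: box d n}|%:R) @[n --> \oo] --> (0 : R).
  by rewrite -[X in _ --> X](mulr0 C); apply: cvgM; [exact: cvg_cst|exact: cvg_bdry].
move=> /cvgrPdist_le /(_ eps eps0) [n _ /(_ n (leqnn n))].
rewrite /= sub0r normrN => hn; have [M hM] := bound n.
exists M => // m /= Mm; rewrite sub0r normrN ger0_norm ?gap_ge0 //.
by apply: le_trans (hM m Mm) _; apply: le_trans (ler_norm _) hn.
Qed.

End Uniqueness.

(** * Limits of local functions and sampling *)

Section InfiniteVolume.
Variables (d : nat) (R : realType) (p q : R).
Hypotheses (p01 : 0 < p < 1) (q1 : 1 <= q) (d0 : (0 < d)%N).
Hypothesis small : p * (1 - p) * (q - 1) ^+ 2 * q ^+ 2 <= 1.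
Implicit Types (e : edge d) (k l : cfg d) (es B : seq (edge d)) (f g h : cfg d -> R).

Local Notation rho := (rho p q).
Local Notation occ := (@occ d R).
Local Notation czero := (@czero d).
Local Notation G m l f := (gexp rho (edges d m) l f).
Local Notation gap := (gap p q).

Let rg e k : 0 < rho e k. Proof. exact: (rho_gt0 p01 q1). Qed.
Let rm e k l : lek k l -> rho e k <= rho e l. Proof. exact: (rho_mono p01 q1). Qed.

Definition local B f := forall k k', (forall e, e \in B -> k e = k' e) -> f k = f k'.
Definition unit_valued f := forall k, 0 <= f k <= 1.

(** If the configurations differ on [B], the right side is at least 1, which already bounds the
    left. *)
Lemma local_diff B f k k' : local B f -> unit_valued f -> lek k k' ->
  `|f k' - f k| <= \sum_(e <- B) (occ e k' - occ e k).
Proof.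
move=> Bf uf kk'.
have t0 e : 0 <= occ e k' - occ e k by rewrite subr_ge0 occ_mono.
case: (boolP (all (fun e => k e == k' e) B)) => [/allP a|/allPn [e eB ne]].
  rewrite (Bf k k') ?subrr ?normr0 ?sumr_ge0 // => e /a /eqP //.
apply: (@le_trans _ _ 1).
  by have := uf k; have := uf k'; rewrite ler_norml; move: (f k) (f k') => a b; lra.
rewrite (perm_big _ (perm_to_rem eB)) big_cons -[X in X <= _]addr0; apply: lerD.
  by rewrite /occ; have := kk' e; move: ne; case: (k e); case: (k' e) => //= _ h; rewrite ?subr0 //; have := h isT.
by apply: sumr_ge0 => e' _.
Qed.

(** The coupling reduces a local observable, monotone or not, to the probabilities of discrepancies
    on [B]. *)
Lemma quasilocal B f m l : local B f -> unit_valued f ->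
  `|G m l f - G m czero f| <= \sum_(e <- B) gap (edges d m) e.
Proof.
move=> Bf uf; pose C F := gcpl rho (edges d m) czero l F.
have diff f' : G m l f' - G m czero f' = C (fun k k' => f' k' - f' k).
  rewrite /C -(gcpl_snd _ (edges d m) czero l) -(gcpl_fst _ (edges d m) czero l) addrC -mulN1r -gcpl_lin.
  by congr gcpl; apply/funext => k; apply/funext => k'; ring.
have bound : C (fun k k' => \sum_(e <- B) (occ e k' - occ e k)) <= \sum_(e <- B) gap (edges d m) e.
  rewrite /C gcpl_sum; apply: ler_sum => e _; rewrite -/(C _) -diff /gap lerD2r.
  by case/andP: (gexp_between p01 q1 (edges d m) l (@occ_mono _ _ e)).
have l0 : lek czero l by [].
rewrite ler_norml diff; apply/andP; split; last first.
  apply: le_trans bound; apply: (gcpl_le rg rm) => // k k' kk' _ _.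
  exact: le_trans (ler_norm _) (local_diff Bf uf kk').
rewrite lerNl -mulN1r -gcpl_scale; apply: le_trans bound; apply: (gcpl_le rg rm) => // k k' kk' _ _.
by rewrite mulN1r; apply: le_trans (local_diff Bf uf kk'); rewrite -normrN ler_norm.
Qed.

Lemma sum_gap_cvg B : \sum_(e <- B) gap (edges d m) e @[m --> \oo] --> (0 : R).
Proof.
elim: B => [|e B IH].
  apply: (@eq_near_cvg _ (fun=> 0)); last exact: cvg_cst.
  by apply: nearW => n; rewrite big_nil.
have h : gap (edges d m) e + \sum_(e <- B) gap (edges d m) e @[m --> \oo] --> (0 + 0 : R).
  by apply: cvgD => //; exact: gap_cvg.
by rewrite addr0 in h; apply: eq_near_cvg h; apply: nearW => n; rewrite big_cons.
Qed.

Lemma gexp_zero_cauchy B f m m' : local B f -> unit_valued f -> (m <= m')%N ->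
  `|G m' czero f - G m czero f| <= \sum_(e <- B) gap (edges d m) e.
Proof.
move=> Bf uf mm'; have sub : {subset edges d m <= edges d m'}.
  by move=> e; rewrite !mem_edges; exact: in_edges_le.
rewrite (gexp_tower_sub p01 q1 czero f (edges_uniq d m) (edges_uniq d m') sub).
have h k := quasilocal m k Bf uf.
set D := \sum_(e <- B) _ in h *; set c := G m czero f in h *.
have h1 : G m' czero (fun k => G m k f) <= c + D.
  rewrite -[X in _ <= X](gexp_cst rho (edges d m') czero); apply: (gexp_le rg) => k _.
  by have := h k; rewrite ler_norml => /andP[_]; rewrite lerBlDl.
have h2 : c - D <= G m' czero (fun k => G m k f).
  rewrite -[X in X <= _](gexp_cst rho (edges d m') czero); apply: (gexp_le rg) => k _.
  by have := h k; rewrite ler_norml => /andP[h0 _]; rewrite lerBlDr -lerBlDl; move: h0; move: (G m k f) => a; lra.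
by rewrite ler_norml; move: h1 h2; move: (G m' czero _) => a; lra.
Qed.

(** [limn] is meaningful only for convergent sequences; the rules below therefore concern local
    observables with values between 0 and 1, or constants. *)
Definition nu f : R := limn (fun m => G m czero f).

Lemma nu_cvg B f : local B f -> unit_valued f -> G m czero f @[m --> \oo] --> nu f.
Proof.
move=> Bf uf; apply: cauchy_cvg; apply: cauchy_exP => eps eps0.
have /cvgrPdist_lt /(_ eps eps0) [m _ hm] := @sum_gap_cvg B.
exists (G m czero f), m => // m' /= mm'; rewrite /ball /= distrC.
apply: le_lt_trans (gexp_zero_cauchy Bf uf mm') _.
have := hm m (leqnn m); rewrite /= sub0r normrN; exact: le_lt_trans (ler_norm _).
Qed.

Lemma localW B B' f : {subset B <= B'} -> local B f -> local B' f.
Proof. by move=> sub Bf k k' kk'; apply: Bf => e /sub; exact: kk'. Qed.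

Lemma nu_cst c : nu (fun=> c) = c.
Proof.
by rewrite /nu; under eq_fun do rewrite gexp_cst; exact: lim_cst.
Qed.

Lemma nuD B f g : local B f -> local B g -> unit_valued f -> unit_valued g ->
  nu (fun k => f k + g k) = nu f + nu g.
Proof.
move=> Bf Bg uf ug; apply: (@cvg_lim R) => //.
have h : G m czero f + G m czero g @[m --> \oo] --> nu f + nu g.
  by apply: cvgD; [exact: (nu_cvg Bf uf)|exact: (nu_cvg Bg ug)].
apply: eq_near_cvg h; apply: nearW => m.
by rewrite -[G m czero f]mul1r -gexp_lin; congr gexp; apply/funext => k; rewrite mul1r.
Qed.

Lemma nuZ B f a : local B f -> unit_valued f -> nu (fun k => a * f k) = a * nu f.
Proof.
move=> Bf uf; apply: (@cvg_lim R) => //.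
have h : a * G m czero f @[m --> \oo] --> a * nu f.
  by apply: cvgM; [exact: cvg_cst|exact: (nu_cvg Bf uf)].
by apply: eq_near_cvg h; apply: nearW => m; rewrite gexp_scale.
Qed.

Lemma nu_bounds B f : local B f -> unit_valued f -> 0 <= nu f <= 1.
Proof.
move=> Bf uf; have b m : 0 <= G m czero f <= 1.
  apply/andP; split.
    by rewrite -[X in X <= _](gexp_cst rho (edges d m) czero); apply: (gexp_le rg) => k _; case/andP: (uf k).
  by rewrite -[X in _ <= X](gexp_cst rho (edges d m) czero); apply: (gexp_le rg) => k _; case/andP: (uf k).
have cv : cvgn (fun m => G m czero f) by apply/cvg_ex; exists (nu f); exact: (nu_cvg Bf uf).
apply/andP; split.
  by apply: limr_ge => //; apply: nearW => m; case/andP: (b m).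
by apply: limr_le => //; apply: nearW => m; case/andP: (b m).
Qed.

(** * Sampling the limit law from a uniform variable *)

Local Notation code := (@choice.pickle (edge d)).

(* The edges are read along the countable encoding [code]; indices that encode no edge
   contribute the constant bit [false]. *)
Definition bit (j : nat) k : bool := if @pickle_inv (edge d) j is Some e then k e else false.

Definition bits_edges (n : nat) : seq (edge d) := pmap (@pickle_inv (edge d)) (iota 0 n).

Lemma mem_bits_edges n e : (code e < n)%N -> e \in bits_edges n.
Proof.
move=> en; rewrite mem_pmap; apply/mapP; exists (code e); first by rewrite mem_iota.
by rewrite pickleK_inv.
Qed.

Definition prefix_event (s : seq bool) k : bool :=
  all (fun j => bit j k == nth false s j) (iota 0 (size s)).

Lemma prefix_event_rcons s b k : prefix_event (rcons s b) k = prefix_event s k && (bit (size s) k == b).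
Proof.
rewrite /prefix_event size_rcons -addn1 iotaD all_cat /= andbT nth_rcons ltnn eqxx add0n; congr (_ && _).
by apply: eq_in_all => j; rewrite mem_iota add0n nth_rcons => /andP[_ ->].
Qed.

Definition prefix_indic s k : R := (prefix_event s k)%:R.

Lemma prefix_indic_unit s : unit_valued (prefix_indic s).
Proof. by move=> k; rewrite /prefix_indic; case: (prefix_event s k); rewrite lexx ler01. Qed.

Lemma bit_local n j k k' : (j < n)%N -> (forall e, e \in bits_edges n -> k e = k' e) ->
  bit j k = bit j k'.
Proof.
rewrite /bit => jn kk'; case E: (pickle_inv j) => [e|//]; apply: kk'; rewrite mem_pmap -E.
by apply: map_f; rewrite mem_iota.
Qed.

Lemma prefix_event_local n s k k' : (size s <= n)%N -> (forall e, e \in bits_edges n -> k e = k' e) ->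
  prefix_event s k = prefix_event s k'.
Proof.
move=> sn kk'; apply: eq_in_all => j; rewrite mem_iota add0n => /andP[_ js].
by rewrite (bit_local (leq_trans js sn) kk').
Qed.

Lemma prefix_indic_local n s : (size s <= n)%N -> local (bits_edges n) (prefix_indic s).
Proof. by move=> sn k k' kk'; rewrite /prefix_indic (prefix_event_local sn kk'). Qed.

Definition prefix_mass s : R := nu (prefix_indic s).

Lemma prefix_mass_nil : prefix_mass [::] = 1. Proof. exact: nu_cst. Qed.

Lemma prefix_mass_ge0 s : 0 <= prefix_mass s.
Proof. by case/andP: (nu_bounds (prefix_indic_local (leqnn (size s))) (@prefix_indic_unit s)). Qed.

Lemma prefix_indic_split s k : prefix_indic s k = prefix_indic (rcons s false) k + prefix_indic (rcons s true) k.
Proof.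
by rewrite /prefix_indic !prefix_event_rcons; case: (prefix_event s k); case: (bit _ k); rewrite /= ?addr0 ?add0r.
Qed.

Lemma prefix_mass_split s : prefix_mass s = prefix_mass (rcons s false) + prefix_mass (rcons s true).
Proof.
rewrite /prefix_mass -(@nuD (bits_edges (size s).+1)); try exact: prefix_indic_unit;
  try by apply: prefix_indic_local; rewrite size_rcons.
by congr nu; apply/funext => k; exact: prefix_indic_split.
Qed.

(** The current interval, with left endpoint [a.1] and length [prefix_mass a.2], is cut according to
    the masses of the two continuations; [false] takes the left piece. *)
Definition bisect_step (x : R) (a : R * seq bool) : R * seq bool :=
  let c := prefix_mass (rcons a.2 false) in
  if x < a.1 + c then (a.1, rcons a.2 false) else (a.1 + c, rcons a.2 true).

Definition bisect (x : R) n := iter n (bisect_step x) (0, [::]).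

Lemma bisect_rcons x n : exists b, (bisect x n.+1).2 = rcons (bisect x n).2 b.
Proof. by rewrite /bisect iterS /bisect_step; case: ifP => _; [exists false|exists true]. Qed.

Lemma size_st x n : size (bisect x n).2 = n.
Proof. by elim: n => [//|n IH]; have [b ->] := bisect_rcons x n; rewrite size_rcons IH. Qed.

Lemma nth_st x n j : (j < n)%N -> nth false (bisect x n).2 j = nth false (bisect x j.+1).2 j.
Proof.
elim: n => [//|n IH]; rewrite ltnS leq_eqVlt => /orP[/eqP -> //|jn].
by have [b ->] := bisect_rcons x n; rewrite nth_rcons size_st jn IH.
Qed.

Lemma bisect_interval n s : size s = n -> exists a, [/\ 0 <= a, a + prefix_mass s <= 1 &
  forall x, 0 <= x < 1 -> ((bisect x n).2 == s) = (a <= x < a + prefix_mass s) /\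
     ((bisect x n).2 = s -> (bisect x n).1 = a)].
Proof.
elim: n s => [|n IH] s.
  move=> /size0nil ->; exists 0; rewrite prefix_mass_nil add0r; split => // x ->; by rewrite eqxx.
case/lastP: s => [//|s b]; rewrite size_rcons => -[] /IH [a [a0 a1 ha]].
have c0 := prefix_mass_ge0 (rcons s false); have c1 := prefix_mass_ge0 (rcons s true).
have hs := prefix_mass_split s.
have E x : 0 <= x < 1 -> ((bisect x n.+1).2 == rcons s b) =
    (a <= x < a + prefix_mass s) && ((x < a + prefix_mass (rcons s false)) == ~~ b).
  move=> x01; have [h1 h2] := ha x x01.
  rewrite /bisect iterS /bisect_step -/(bisect x n); case: (eqVneq (bisect x n).2 s) h1 h2 => [es <- /(_ es) ->|ne <- _].
    by rewrite es; case: ifP => _; rewrite eqseq_rcons eqxx; case: b.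
  by case: ifP => _; rewrite eqseq_rcons (negbTE ne).
case: b E => E.
  exists (a + prefix_mass (rcons s false)); split; [by lra|by lra|move=> x x01; split].
    rewrite E //=; apply/andP/andP => [[/andP[ax xs] /eqP/negbT]|[h1 h2]].
      by rewrite -leNgt => h; split => //; lra.
    split; first by apply/andP; split; lra.
    by apply/eqP/negbTE; rewrite -leNgt.
  move=> e; have := E x x01; rewrite e eqxx => /esym /andP[ax].
  have [h1 h2] := ha x x01; move/eqP: (h1); rewrite ax => /eqP/eqP es.
  by rewrite /bisect iterS /bisect_step -/(bisect x n) es (h2 es); case: ltP.
exists a; split; [by lra|by lra|move=> x x01; split].
  rewrite E //=; apply/andP/andP => [[/andP[ax xs] /eqP h]|[h1 h2]]; first by rewrite h.
  by split; [apply/andP; split => //; lra|rewrite h2].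
move=> e; have := E x x01; rewrite e eqxx => /esym /andP[ax].
have [h1 h2] := ha x x01; move/eqP: (h1); rewrite ax => /eqP/eqP es.
by rewrite /bisect iterS /bisect_step -/(bisect x n) es (h2 es); case: ltP.
Qed.

(** The prefix of length [(code e).+1] is the first to contain the bit of [e]. Points outside the
    unit interval give the all-low configuration. *)
Definition sample (x : R) : cfg d :=
  fun e => (0 <= x < 1) && nth false (bisect x (code e).+1).2 (code e).

Lemma bit_sample x n j : 0 <= x < 1 -> (j < n)%N -> bit j (sample x) = nth false (bisect x n).2 j.
Proof.
move=> x01 jn; rewrite (nth_st x jn) /bit.
case E: (pickle_inv j) => [e|].
  have ej : code e = j by have := @pickle_invK (edge d) j; rewrite E.
  by rewrite /sample x01 ej.
(* At an index encoding no edge, the continuation by [true] has mass 0, so its interval is empty and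
   the bisection can only choose [false]. *)
have [b eb] := bisect_rcons x j; rewrite eb nth_rcons size_st ltnn eqxx.
case: b eb => // eb; have [a [_ _ ha]] := bisect_interval (size_st x j.+1).
have [h _] := ha x x01; move: h; rewrite eqxx eb.
have -> : prefix_mass (rcons (bisect x j).2 true) = 0.
  rewrite /prefix_mass -(nu_cst 0); congr nu; apply/funext => k.
  by rewrite /prefix_indic prefix_event_rcons /bit size_st E andbF.
by rewrite addr0 => /esym/andP[h1 h2]; have := lt_le_trans h2 h1; rewrite ltxx.
Qed.

Lemma prefix_event_sample x s : 0 <= x < 1 -> prefix_event s (sample x) = ((bisect x (size s)).2 == s).
Proof.
move=> x01; apply/allP/eqP => [h|h j].
  apply: (@eq_from_nth _ false); rewrite size_st // => j js.
  by rewrite -(bit_sample x01 js); apply/eqP/h; rewrite mem_iota.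
by rewrite mem_iota add0n => /andP[_ js]; rewrite (bit_sample x01 js) h.
Qed.

Lemma prefix_event_sample_interval s : exists a, [/\ 0 <= a, a + prefix_mass s <= 1 &
  forall x, 0 <= x < 1 -> prefix_event s (sample x) = (a <= x < a + prefix_mass s)].
Proof.
have [a [a0 a1 ha]] := bisect_interval (erefl (size s)).
by exists a; split => // x x01; rewrite prefix_event_sample //; case: (ha x x01).
Qed.

End InfiniteVolume.

(** * Measurability *)

Section OmegaMeasurability.
Variables (d : nat) (R : realType).
Implicit Types (e : edge d) (B : seq (edge d)).

Lemma measurable_coord e (b : bool) : measurable [set k : Omega d | k e = b].
Proof. by apply: sub_sigma_algebra; exists e, b. Qed.

Lemma measurable_eval e : measurable_fun [set: Omega d] (fun k : Omega d => k e).
Proof.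
apply: (measurable_fun_bool true); rewrite setTI; exact: measurable_coord.
Qed.

Lemma measurable_to_Omega (dT : measure_display) (T : measurableType dT) (X : T -> Omega d) :
  (forall e, measurable [set x | X x e]) -> measurable_fun [set: T] X.
Proof.
move=> mX; apply: (@measurability _ _ T (Omega d) setT X (@cylinders d)) => //.
move=> _ [_ [e [b ->]] <-]; rewrite setTI; case: b.
  exact: mX.
have -> : X @^-1` [set k | k e = false] = ~` [set x | X x e].
  by apply/seteqP; split => x /=; case: (X x e).
exact: measurableC.
Qed.

Lemma measurable_local B (h : Omega d -> R) : local B h -> measurable_fun [set: Omega d] h.
Proof.
elim: B h => [|e B IH] h hB.
  have -> : h = cst (h (fun=> false)) by apply/funext => k; apply: hB.
  exact: measurable_cst.
have -> : h = (fun k => if k e then h (setb e true k) else h (setb e false k)).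
  by apply/funext => k; rewrite -{1}[k](setb_id e); case: (k e).
have hb b : measurable_fun [set: Omega d] (fun k : Omega d => h (setb e b k)).
  apply: IH => k k' kk'; apply: hB => f; rewrite inE /setb; case: eqP => //= _; exact: kk'.
by apply: measurable_fun_ifT => //; exact: measurable_eval.
Qed.

Variables (p q : R).
Hypothesis q1 : 1 <= q.
Hypothesis gamma_cvg : forall (E : {fset edge d}) l (t : {ffun E -> bool}),
  gammaN p q N E (upd l t) l @[N --> \oo] --> gamma p q E (upd l t) l.

Lemma measurable_upd (E : {fset edge d}) (t : {ffun E -> bool}) :
  measurable_fun [set: Omega d] (fun l : Omega d => upd l t : Omega d).
Proof.
apply: measurable_to_Omega => e; rewrite /upd; case: insubP => [e' _ _|eE].
  case: (t e'); first by rewrite (_ : [set x | _] = setT) //; apply/seteqP.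
  by rewrite (_ : [set x | _] = set0) //; apply/seteqP; split.
exact: measurable_coord.
Qed.

Lemma measurable_gamma (E : {fset edge d}) (t : {ffun E -> bool}) :
  measurable_fun [set: Omega d] (fun l : Omega d => gamma p q E (upd l t) l).
Proof.
apply: (@measurable_fun_cvg _ _ _ _
  (fun N (l : Omega d) => gammaN p q N E (upd l t) l)) => [N|l _]; last exact: gamma_cvg.
apply: (@measurable_local (edges d N)) => k k' kk'; rewrite /gammaN !asboolT; try exact: upd_agree.
have W t' : weight p q N (upd k t') = weight p q N (upd k' t').
  apply: weight_local => // f fN; rewrite /upd; case: insubP => // _.
  by apply: kk'; rewrite mem_edges.
by rewrite W; congr (_ / _); apply: eq_bigr => t' _; rewrite W.
Qed.

Lemma measurable_gammaA (E : {fset edge d}) (A : set (Omega d)) : measurable A ->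
  measurable_fun [set: Omega d] (fun l : Omega d => gammaA p q E A l).
Proof.
move=> mA; apply: measurable_sum => t; apply: measurable_funM; last exact: measurable_gamma.
apply: measurable_fun_ifT => //; apply: (measurable_fun_bool true); rewrite setTI.
have -> : (fun l : Omega d => `[< A (upd l t) >]) @^-1` [set true] =
    (fun l : Omega d => upd l t : Omega d) @^-1` A.
  by apply/seteqP; split => l /= /asboolP.
by rewrite -[X in measurable X]setTI; apply: measurable_upd.
Qed.

(** A generating pi-system made of increasing events, on which boundary conditions can be compared
    monotonically. *)
Definition all_high B : set (Omega d) := [set k : cfg d | all k B].

Lemma measurable_all_high B : measurable (all_high B).
Proof.
elim: B => [|e B IH]; first by rewrite (_ : all_high [::] = setT) //; apply/seteqP; split.
have -> : all_high (e :: B) = [set k : Omega d | k e = true] `&` all_high B.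
  by apply/seteqP; split => k /= /andP.
by apply: measurableI => //; exact: measurable_coord.
Qed.

Lemma all_high_setI : setI_closed (range all_high).
Proof.
move=> _ _ [B _ <-] [B' _ <-]; exists (B ++ B') => //.
by apply/seteqP; split => k; rewrite /all_high /= all_cat => /andP.
Qed.

Lemma measurable_gen : @measurable _ (Omega d) = <<s range all_high >>.
Proof.
apply/seteqP; split => A.
  apply: smallest_sub; first exact: smallest_sigma_algebra.
  move=> _ [e [b ->]]; have h : <<s range all_high >> [set k : cfg d | k e = true].
    apply: sub_sigma_algebra; exists [:: e] => //.
    by apply/seteqP; split => k; rewrite /all_high /= andbT.
  case: b => //; have -> : [set k : cfg d | k e = false] = setT `\` [set k | k e = true].
    by apply/seteqP; split => k /=; [move=> ->|case=> _; case: (k e)].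
  exact: (sigma_algebraCD h).
apply: smallest_sub; first exact: sigma_algebra_measurable.
by move=> _ [B _ <-]; exact: measurable_all_high.
Qed.

Lemma eq_probability (mu mu' : probability (Omega d) R) :
  (forall B, mu (all_high B) = mu' (all_high B)) ->
  forall A, measurable A -> mu A = mu' A.
Proof.
move=> h; apply: (@measure_unique _ _ _ (range all_high) (fun=> setT)).
- exact: measurable_gen.
- exact: all_high_setI.
- by move=> _; exists [::] => //; apply/seteqP; split.
- by apply/seteqP; split => // k _; exists 0%N.
- by move=> _ [B _ <-]; exact: h.
- by move=> k /=; rewrite probability_setT ltry.
Qed.

Section Integrals.
Variable mu : probability (Omega d) R.
Implicit Types (h : Omega d -> R).
Local Notation I h := (\int[mu]_l (h l)%:E)%E.
Local Notation mfun h := (measurable_fun [set: Omega d] (h : Omega d -> R)).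

Lemma measurable_EFinh h : mfun h -> measurable_fun [set: Omega d] (fun l => (h l)%:E).
Proof. by move=> mh; apply/measurable_EFinP. Qed.

Lemma integral_cst_prob (c : R) : (\int[mu]_l c%:E = c%:E)%E.
Proof. by rewrite integral_cst //; rewrite [X in (_ * X)%E](@probability_setT _ _ _ mu) mule1. Qed.

Lemma integral_between h (a b : R) : mfun h -> 0 <= a -> (forall l, a <= h l <= b) ->
  (a%:E <= I h <= b%:E)%E.
Proof.
move=> mh a0 hab.
rewrite -{1}(integral_cst_prob a) -(integral_cst_prob b).
apply/andP; split; apply: ge0_le_integral => //; try exact: measurable_EFinh;
  try exact: measurable_cst; move=> l _; rewrite lee_fin; have /andP[h1 h2] := hab l => //.
exact: le_trans h1.
Qed.

Lemma integral_bounded_cvg (h_ : nat -> Omega d -> R) h :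
  (forall n, mfun (h_ n)) -> mfun h -> (forall n, unit_valued (h_ n)) ->
  (forall l, h_ n l @[n --> \oo] --> h l) -> I (h_ n) @[n --> \oo] --> I h.
Proof.
move=> mh_ mh uh hh.
apply: (@dominated_cvg _ _ _ mu setT measurableT (fun n l => (h_ n l)%:E) (fun l => (h l)%:E) (cst 1%E)).
- by move=> n; exact: measurable_EFinh.
- by move=> l _; apply: cvg_EFin; [apply: nearW|exact: hh].
- by [].
- by apply: finite_measure_integrable_cst.
- move=> n l _; rewrite /cst abse_EFin lee_fin ger0_norm; by case/andP: (uh n l).
Qed.

End Integrals.
End OmegaMeasurability.

(** * The Gibbs measure *)

Section UnitInterval.
Variable R : realType.

Definition unit_leb : set (measurableTypeR R) -> \bar R :=
  mrestr (@lebesgue_measure R) (measurable_itv `[(0 : R), 1[).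

HB.instance Definition _ := Measure.on unit_leb.

Lemma unit_leb_setT : unit_leb setT = 1%E.
Proof.
rewrite /unit_leb /mrestr setTI lebesgue_measure_itv /= lte_fin ltr01.
by rewrite oppr0 adde0.
Qed.

HB.instance Definition _ := Measure_isProbability.Build _ _ _ unit_leb unit_leb_setT.

Lemma unit_leb_itv (A : set R) (a c : R) : 0 <= a -> 0 <= c -> a + c <= 1 ->
  (forall x, 0 <= x < 1 -> A x <-> a <= x < a + c) -> unit_leb A = c%:E.
Proof.
move=> a0 c0 ac hA; rewrite /unit_leb /mrestr.
have -> : A `&` [set` `[0, 1[] = [set` `[a, a + c[].
  apply/seteqP; split => x /=; rewrite !in_itv /=.
    by case=> Ax x01; apply/hA.
  move=> /andP[h1 h2]; have x01 : 0 <= x < 1.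
    by rewrite (le_trans a0 h1) (lt_le_trans h2 ac).
  by split => //; apply/hA => //; rewrite h1.
rewrite lebesgue_measure_itv /= lte_fin ltrDl.
case: ltP => [_|c0']; first by rewrite EFinN -EFinB addrAC subrr add0r.
by congr EFin; apply/eqP; rewrite eq_le c0 c0'.
Qed.

End UnitInterval.

Section GibbsMeasure.
Variables (d : nat) (R : realType) (p q : R).
Hypotheses (p01 : 0 < p < 1) (q1 : 1 <= q) (d0 : (0 < d)%N).
Hypothesis small : p * (1 - p) * (q - 1) ^+ 2 * q ^+ 2 <= 1.
Implicit Types (e : edge d) (k l : cfg d) (es B : seq (edge d)) (f g h : cfg d -> R).

Local Notation rho := (rho p q).
Local Notation czero := (@czero d).
Local Notation G m l f := (gexp rho (edges d m) l f).
Local Notation nu := (@nu d R p q).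
Local Notation prefix_mass := (@prefix_mass d R p q).
Local Notation bisect := (@bisect d R p q).
Local Notation sample := (@sample d R p q).

Let rg e k : 0 < rho e k. Proof. exact: (rho_gt0 p01 q1). Qed.
Let rm e k l : lek k l -> rho e k <= rho e l. Proof. exact: (rho_mono p01 q1). Qed.

Definition high B k : R := (all k B)%:R.

Lemma high_unit B : unit_valued (high B).
Proof. by move=> k; rewrite /high; case: (all k B); rewrite lexx ler01. Qed.

Lemma high_local B : local B (high B).
Proof. by move=> k k' kk'; rewrite /high (eq_in_all kk'). Qed.

Lemma high_mono B k k' : lek k k' -> high B k <= high B k'.
Proof.
move=> kk'; rewrite ler_nat; case E : (all k B) => //.
by have -> : all k' B by apply: sub_all E => e; exact: kk'.
Qed.

Lemma indic_all_high B : \1_(all_high B) = high B.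
Proof.
apply/funext => k; rewrite indicE /high; case E: (all k B).
  by rewrite mem_set.
by rewrite memNset // /all_high /= E.
Qed.

Lemma gammaA_high (E : {fset edge d}) B l :
  gammaA p q E (all_high B) l = gexp rho (enum_fset E) l (high B).
Proof. by rewrite gammaA_gexp // indic_all_high. Qed.

(** The Gibbs equation for the edges of box [m] averages over boundary conditions, and all of these
    give the same value up to a vanishing sum of gaps. *)
Lemma gibbs_high (mu : probability (Omega d) R) B : gibbs p q mu ->
  mu (all_high B) = (nu (high B))%:E.
Proof.
move=> gmu; have mA := measurable_all_high B.
have bound m : ((G m czero (high B))%:E <= mu (all_high B) <=
    (G m czero (high B) + \sum_(e <- B) gap p q (edges d m) e)%:E)%E.
  pose E := [fset e in edges d m]%fset.
  have EG l : gammaA p q E (all_high B) l = G m l (high B).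
    rewrite gammaA_high; apply: gexp_rho_perm; rewrite ?fset_uniq ?edges_uniq // => e.
    by rewrite !inE.
  rewrite -(gmu E _ mA); apply: integral_between.
  - by apply: measurable_gammaA => // *; exact: gammaN_cvg.
  - rewrite -[X in X <= _](gexp_cst rho (edges d m) czero); apply: (gexp_le rg) => k _.
    by case/andP: (high_unit B k).
  - move=> l; rewrite EG; apply/andP; split; first exact: gexp_rho_mono (@high_mono B).
    have := quasilocal p01 q1 m l (@high_local B) (@high_unit B).
    by rewrite ler_norml => /andP[_]; rewrite lerBlDl.
have mufin : mu (all_high B) \is a fin_num by rewrite fin_num_measure.
rewrite -(fineK mufin); congr EFin; symmetry; apply: (@cvg_lim R) => //.
apply: (@squeeze_cvgr _ _ _ _
  (fun m => fine (mu (all_high B)) - \sum_(e <- B) gap p q (edges d m) e)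
  (fun=> fine (mu (all_high B)))).
- apply: nearW => m; have := bound m; rewrite -(fineK mufin) !lee_fin => /andP[h1 h2].
  by rewrite h1 lerBlDr h2.
- rewrite -[X in _ --> X]subr0; apply: cvgB; [exact: cvg_cst|exact: sum_gap_cvg].
- exact: cvg_cst.
Qed.

(** * Realising the limit law as a measure *)

Lemma measurable_sample : measurable_fun [set: measurableTypeR R] (sample : R -> Omega d).
Proof.
apply: measurable_to_Omega => e; set n := (@choice.pickle (edge d) e).+1.
pose F (i : nat) : set R := if (@choice.unpickle (seq bool) i) is Some s then
  if (size s == n) && nth false s (@choice.pickle (edge d) e)
  then [set x | 0 <= x < 1 /\ (bisect x n).2 == s] else set0 else set0.
(* Decompose according to the prefix that decides [e]: there are countably many, each giving an
   interval. *)
have -> : [set x | sample x e] = \bigcup_i F i.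
  apply/seteqP; split => x /=.
    rewrite /sample => /andP[x01 h]; exists (@choice.pickle (seq bool) (bisect x n).2) => //.
    by rewrite /F choice.pickleK size_st // eqxx h /= eqxx.
  case=> i _; rewrite /F; case: (choice.unpickle i) => // s; case: ifP => // /andP[_ h] [x01 /eqP es].
  by rewrite /sample x01 es.
apply: bigcupT_measurable => i; rewrite /F; case: (choice.unpickle i) => // s; case: ifP => // /andP[/eqP sn _].
have [a [a0 a1 ha]] := bisect_interval p01 q1 d0 small sn.
rewrite (_ : [set x | _] = [set` `[a, a + prefix_mass s[]); first exact: measurable_itv.
apply/seteqP; split => x /=; rewrite in_itv /=.
  by case=> x01; case: (ha x x01) => ->.
move=> h; have x01 : 0 <= x < 1.
  by case/andP: h => h1 h2; rewrite (le_trans a0 h1) (lt_le_trans h2 a1).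
by split => //; case: (ha x x01) => ->.
Qed.

Definition sampleO : measurableTypeR R -> Omega d := sample.

HB.instance Definition _ :=
  isMeasurableFun.Build _ _ (measurableTypeR R) (Omega d) sampleO measurable_sample.

Definition gibbs_mu : probability (Omega d) R := distribution (@unit_leb R) sampleO.

Definition expect (h : Omega d -> R) : \bar R := (\int[gibbs_mu]_l (h l)%:E)%E.
Local Notation I := expect.

Lemma gibbs_mu_evt s : gibbs_mu [set k | prefix_event s k] = (prefix_mass s)%:E.
Proof.
have [a [a0 a1 ha]] := prefix_event_sample_interval p01 q1 d0 small s.
apply: (unit_leb_itv a0 (prefix_mass_ge0 p01 q1 d0 small s) a1) => x x01.
by rewrite /= ha.
Qed.

(** Induction on the number [m] of bits that [h] may read beyond the prefix [s], splitting the event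
    on the next bit; for [m = 0], [h] is constant on the event. *)
Lemma integral_evt_local m s h : local (bits_edges d (size s + m)) h -> unit_valued h ->
  I (fun k => prefix_indic R s k * h k) = (nu (fun k => prefix_indic R s k * h k))%:E.
Proof.
have prodL n s' h' : (size s' <= n)%N -> local (bits_edges d n) h' ->
    local (bits_edges d n) (fun k => prefix_indic R s' k * h' k).
  by move=> sn Lh k k' kk'; rewrite (@prefix_indic_local d R _ _ sn _ _ kk') (Lh k k' kk').
have prodU s' h' : unit_valued h' -> unit_valued (fun k => prefix_indic R s' k * h' k).
  move=> uh k; have /andP[h0 h1] := uh k; have /andP[e0 e1] := @prefix_indic_unit d R s' k.
  by rewrite mulr_ge0 //= -[X in _ <= X]mulr1 ler_pM.
elim: m s => [|m IH] s Lh uh.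
  rewrite addn0 in Lh.
  (* A representative [k0] supplies the constant value of [h]. The event is empty when [s] has
     [true] at an index encoding no edge. *)
  have [[k0 ek0]|no] := pselect (exists k0, prefix_event s k0); last first.
    have -> : (fun k => prefix_indic R s k * h k) = (fun=> 0).
      apply/funext => k; rewrite /prefix_indic; case E: (prefix_event s k); last by rewrite mul0r.
      by case: no; exists k.
    by rewrite nu_cst; exact: integral_cst_prob.
  have -> : (fun k => prefix_indic R s k * h k) = (fun k => h k0 * prefix_indic R s k).
    apply/funext => k; rewrite /prefix_indic; case E: (prefix_event s k); last by rewrite mul0r mulr0.
    rewrite mul1r mulr1; apply: Lh => e; rewrite mem_pmap => /mapP [j].
    rewrite mem_iota add0n => /andP[_ js] je.
    have := allP E j; have := allP ek0 j; rewrite !mem_iota add0n js => /(_ isT)/eqP h1 /(_ isT)/eqP.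
    by rewrite -h1 /bit -je.
  have L := @prefix_indic_local d R _ _ (leqnn (size s)).
  rewrite (nuZ p01 q1 d0 small _ L (@prefix_indic_unit d R s)).
  rewrite /expect; have -> : (fun k : Omega d => (h k0 * prefix_indic R s k)%:E) = (fun k => ((h k0)%:E * (prefix_indic R s k)%:E)%E).
    by apply/funext => k; rewrite EFinM.
  have mE : measurable_fun [set: Omega d] (prefix_indic R s : Omega d -> R) by exact: measurable_local L.
  rewrite ge0_integralZl //; last 3 first.
  - exact: measurable_EFinh.
  - by move=> k _; rewrite lee_fin; case/andP: (@prefix_indic_unit d R s k).
  - by rewrite lee_fin; case/andP: (uh k0).
  rewrite EFinM; congr (_ * _)%E; rewrite -gibbs_mu_evt.
  have mS : measurable ([set k | prefix_event s k] : set (Omega d)).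
    have := mE measurableT [set 1] (measurable_set1 1); rewrite setTI.
    congr measurable; apply/seteqP; split => k /=; rewrite /prefix_indic; case: (prefix_event s k) => //= /eqP.
      by rewrite eq_sym oner_eq0.
  have -> : gibbs_mu [set k | prefix_event s k] =
      (\int[gibbs_mu]_k (\1_([set k | prefix_event s k] : set (Omega d)) k)%:E)%E.
    by rewrite integral_indic // setIT.
  apply: eq_integral => k _; rewrite indicE /prefix_indic; congr (_%:R%:E).
  by case E: (prefix_event s k); [rewrite mem_set|rewrite memNset //= E].
have ss b : (size (rcons s b) + m = size s + m.+1)%N by rewrite size_rcons addSnnS.
have Lb b : local (bits_edges d (size s + m.+1)) (fun k => prefix_indic R (rcons s b) k * h k).
  by apply: prodL => //; rewrite -(ss b) leq_addr.
have spl : (fun k => prefix_indic R s k * h k) = (fun k => prefix_indic R (rcons s false) k * h k + prefix_indic R (rcons s true) k * h k).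
  by apply/funext => k; rewrite (prefix_indic_split R s k) mulrDl.
rewrite spl (nuD p01 q1 d0 small (Lb false) (Lb true)); try exact: prodU.
have hb b : I (fun k => prefix_indic R (rcons s b) k * h k) = (nu (fun k => prefix_indic R (rcons s b) k * h k))%:E.
  by apply: IH => //; rewrite ss.
rewrite EFinD -!hb /expect -ge0_integralD //; try (by move=> k _; rewrite lee_fin; case/andP: (prodU (rcons s false) h uh k));
  try (by move=> k _; rewrite lee_fin; case/andP: (prodU (rcons s true) h uh k));
  try (by apply: measurable_EFinh; exact: measurable_local (Lb _)).
Qed.

Lemma integral_local B h : local B h -> unit_valued h -> I h = (nu h)%:E.
Proof.
move=> Bh uh; pose n := (\max_(e <- B) (@choice.pickle (edge d) e).+1)%N.
have Lh : local (bits_edges d (size ([::] : seq bool) + n)) h.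
  apply: localW Bh => e eB; apply: mem_bits_edges; exact: (@leq_bigmax_seq _ B xpredT (fun e => (@choice.pickle (edge d) e).+1) e eB isT).
have := integral_evt_local Lh uh.
by have -> : (fun k => prefix_indic R [::] k * h k) = h by apply/funext => k; rewrite /prefix_indic /prefix_event /= mul1r.
Qed.

(** Truncation makes observables local and approximates [k] from below, the direction covered by
    [lim_res_left]. *)
Definition mask (n : nat) k : cfg d := fun e => in_edges n e && k e.

Lemma lek_mask n k : lek (mask n k) k.
Proof. by move=> e /andP[]. Qed.

Lemma mask_mono n k k' : lek k k' -> lek (mask n k) (mask n k').
Proof. by move=> kk' e /andP[en /kk' ke]; rewrite /mask en. Qed.

Lemma mask_edges n N k : (N <= n)%N -> forall e, in_edges N e -> mask n k e = k e.
Proof. by move=> Nn e fN; rewrite /mask (in_edges_le Nn fN). Qed.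

(** The kernel applied to [high B] need not be local, so [integral_local] is applied to truncated
    versions [g_ n], which converge to it from below; the values [nu (g_ n)] are squeezed. *)
Lemma integral_gexp_high es B : uniq es ->
  I (fun l => gexp rho es l (high B)) = (nu (high B))%:E.
Proof.
move=> ues; pose f := high B; pose g l := gexp rho es l f.
have fm := @high_mono B.
have gm k k' : lek k k' -> g k <= g k' by move=> kk'; exact: gexp_rho_mono.
have gu : unit_valued g.
  move=> k; apply/andP; split.
    by rewrite -[X in X <= _](gexp_cst rho es k); apply: (gexp_le rg) => l _; case/andP: (high_unit B l).
  by rewrite -[X in _ <= X](gexp_cst rho es k); apply: (gexp_le rg) => l _; case/andP: (high_unit B l).
pose g_ n l := g (mask n l).
have gn_local n : local (edges d n) (g_ n).
  move=> k k' kk'; congr g; apply/funext => e; rewrite /mask.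
  by case en : (in_edges n e) => //=; apply: kk'; rewrite mem_edges.
have gn_unit n : unit_valued (g_ n) by move=> k; exact: gu.
have gn_cvg l : g_ n l @[n --> \oo] --> g l.
  (* Once box [n] contains [es], truncating the boundary condition amounts to truncating inside the
     odds and the observable. *)
  have h : gexp (fun e k => rho e (mask n k)) es l (fun k => f (mask n k)) @[n --> \oo] --> g l.
    apply: gexp_cvg => // [e k _|k _].
      apply: odds_cvg => //; [exact: lim_res_ge0| apply: lim_res_left => // [n|N]; first exact: lek_mask].
      by exists N => // n /= Nn f' f'N; exact: mask_edges f'N.
    apply: cvg_near_cst; have [N _ hN] := subset_edges B.
    exists N => // n /= Nn; apply: (@high_local B (mask n k) k) => e eB.
    by apply: (mask_edges _ (leqnn n)); rewrite -mem_edges; exact: hN.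
  apply: eq_near_cvg h; apply: filterS (subset_edges es) => n esn.
  have hm := @gexp_map _ _ rho (fun e k => rho e (mask n k)) id (mask n) es l f.
  rewrite map_id in hm; apply/esym; apply: hm => // e b k ees.
  apply/funext => e'; rewrite /mask /setb; case: eqP => // ->.
  by rewrite -mem_edges esn.
have gn_meas n : measurable_fun [set: Omega d] (g_ n : Omega d -> R) by exact: measurable_local (gn_local n).
have g_meas : measurable_fun [set: Omega d] (g : Omega d -> R).
  by apply: (@measurable_fun_cvg _ _ _ _ (fun n (l : Omega d) => g_ n l)).
have Icvg : I (g_ n) @[n --> \oo] --> I g by exact: integral_bounded_cvg.
have Ig n : I (g_ n) = (nu (g_ n))%:E by exact: integral_local (gn_local n) _.
suff Icvg' : nu (g_ n) @[n --> \oo] --> nu f.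
  have h : (nu (g_ n))%:E @[n --> \oo] --> (nu f)%:E by apply: cvg_EFin => //; exact: nearW.
  rewrite (_ : (fun n => (nu (g_ n))%:E) = (fun n => I (g_ n))) in h; last by apply/funext.
  exact: (cvg_unique _ Icvg h).
have fcvg : G m czero f @[m --> \oo] --> nu f.
  exact: nu_cvg (@high_local B) (@high_unit B).
have tower m : {subset es <= edges d m} -> G m czero f = G m czero g.
  by move=> esm; exact: gexp_tower_sub (edges_uniq d m) esm.
apply: (@squeeze_cvgr _ _ _ _ (fun n => G n czero f) (fun=> nu f)) => //; last exact: cvg_cst.
apply: filterS (subset_edges es) => n esn.
have gncv : G m czero (g_ n) @[m --> \oo] --> nu (g_ n) by exact: nu_cvg (gn_local n) _.
have gncv' : cvgn (fun m => G m czero (g_ n)) by apply/cvg_ex; exists (nu (g_ n)).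
(* Lower bound: all low is the least boundary condition, and configurations low outside box [n] are
   their own truncations. Upper bound: [g_ n] is at most [g], whose mean in large boxes is that of
   [f] by the tower property. *)
apply/andP; split.
  apply: limr_ge => //; exists n => // m /= nm.
  have sub : {subset edges d n <= edges d m} by move=> e; rewrite !mem_edges; exact: in_edges_le.
  rewrite (gexp_tower_sub p01 q1 czero (g_ n) (edges_uniq d n) (edges_uniq d m) sub).
  rewrite -[X in X <= _](gexp_cst rho (edges d m) czero); apply: (gexp_le rg) => k _.
  rewrite (tower n esn).
  have -> : G n czero g = G n czero (g_ n).
    apply: (eq_gexp rg) => k' a; congr g; apply/funext => e; rewrite /mask.
    by case en : (in_edges n e) => //; rewrite a // mem_edges en.
  apply: gexp_rho_mono => // k1 k2 k12; apply: gm; exact: mask_mono.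
have fcv : cvgn (fun m => G m czero f) by apply/cvg_ex; exists (nu f).
apply: ler_lim => //.
apply: filterS (subset_edges es) => m esm; rewrite (tower m esm); apply: (gexp_le rg) => k _.
by apply: gm; exact: lek_mask.
Qed.

(** The equation holds on the pi-system of [all_high] events by [integral_gexp_high], and both sides
    behave as measures in the event, so Dynkin induction extends it. *)
Lemma gibbs_gibbs_mu : gibbs p q gibbs_mu.
Proof.
move=> E A mA; set es := enum_fset E.
have ues : uniq es by exact: fset_uniq.
have gE A' l : gammaA p q E A' l = gexp rho es l (\1_A') by exact: gammaA_gexp.
have gU A' : unit_valued (fun l => gammaA p q E A' l).
  move=> l; rewrite gE; have iU k : 0 <= (\1_A' k : R) <= 1.
    by rewrite indicE; case: (_ \in _); rewrite lexx ler01.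
  apply/andP; split.
    by rewrite -[X in X <= _](gexp_cst rho es l); apply: (gexp_le rg) => k _; case/andP: (iU k).
  by rewrite -[X in _ <= X](gexp_cst rho es l); apply: (gexp_le rg) => k _; case/andP: (iU k).
have gM (A' : set (Omega d)) : measurable A' -> measurable_fun [set: Omega d] (fun l : Omega d => gammaA p q E A' l).
  by move=> mA'; apply: measurable_gammaA => // *; exact: gammaN_cvg.
have hi B : I (fun l => gammaA p q E (all_high B) l) = gibbs_mu (all_high B).
  have -> : (fun l => gammaA p q E (all_high B) l) = (fun l => gexp rho es l (high B)).
    by apply/funext => l; rewrite gE indic_all_high.
  rewrite integral_gexp_high // -(integral_local (@high_local B) (@high_unit B)) -indic_all_high.
  by rewrite /expect integral_indic ?setIT //; exact: measurable_all_high.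
have mAg : <<s range (@all_high d) >> A by rewrite -measurable_gen.
pose P := [set A | I (fun l => gammaA p q E A l) = gibbs_mu A].
apply: (@dynkin_induction _ (Omega d) (range (@all_high d)) P _ _ _ _ _ _ A mAg).
- exact: measurable_gen.
- exact: all_high_setI.
- by have := hi [::]; rewrite (_ : all_high [::] = setT) //; apply/seteqP; split.
- by move=> _ [B _ <-]; exact: hi.
- move=> S mS PS; have PS' : I (fun l => gammaA p q E S l) = gibbs_mu S := PS.
  have C : gibbs_mu (~` S) = (1 - gibbs_mu S)%E by exact: probability_setC.
  suff : I (fun l => gammaA p q E (~` S) l) = gibbs_mu (~` S) by [].
  rewrite C -PS' /expect.
  have -> : (fun l => (gammaA p q E (~` S) l)%:E) = (fun l => (1 - gammaA p q E S l)%:E).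
    apply/funext => l; congr EFin; rewrite !gE -[X in _ = X - _](gexp_cst rho es l) -gexpB.
    congr gexp; apply/funext => k; rewrite indicC indicE.
    by case: (k \in S); rewrite /= ?subrr ?subr0.
  rewrite integralB_EFin //; last 2 first.
  + by apply: finite_measure_integrable_cst.
  + apply: (@le_integrable _ _ _ gibbs_mu setT _ _ (cst 1%E)) => //.
    * by apply: measurable_EFinh; exact: gM.
    * by move=> l _; rewrite /cst /= lee_fin normr1 ger0_norm; case/andP: (gU S l).
    * by apply: finite_measure_integrable_cst.
  by rewrite integral_cst_prob.
- move=> F mF tF PF.
  suff : I (fun l => gammaA p q E (\bigcup_k F k) l) = gibbs_mu (\bigcup_k F k) by [].
  (* Finite unions come first, by additivity; then bounded convergence on the left and continuity
     from below on the right. *)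
  pose U n := \big[setU/set0]_(i < n) F i.
  have mU n : measurable (U n) by apply: bigsetU_measurable => i _.
  have PU n : I (fun l => gammaA p q E (U n) l) = gibbs_mu (U n).
    elim: n => [|n IH].
      rewrite /U big_ord0 measure0; have -> : (fun l => gammaA p q E set0 l) = (fun=> 0).
        apply/funext => l; rewrite gE -[RHS](gexp_cst rho es l); congr gexp.
        by apply/funext => k; rewrite indic0.
      exact: integral_cst_prob.
    have dj : U n `&` F n = set0.
      rewrite /U big_distrl /= big1 // => i _; apply/seteqP; split => // x [h1 h2].
      have /trivIsetP tF' := tF; have := tF' i n Logic.I Logic.I.
      by rewrite neq_ltn ltn_ord => /(_ isT) h; rewrite -h.
    have -> : U n.+1 = U n `|` F n by rewrite /U big_ord_recr.
    have PFn : I (fun l => gammaA p q E (F n) l) = gibbs_mu (F n) := PF n.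
    have add : gibbs_mu (U n `|` F n) = (gibbs_mu (U n) + gibbs_mu (F n))%E.
      by apply: measureU.
    rewrite add -IH -PFn /expect.
    have -> : (fun l => (gammaA p q E (U n `|` F n) l)%:E) =
        (fun l => ((gammaA p q E (U n) l)%:E + (gammaA p q E (F n) l)%:E)%E).
      apply/funext => l; rewrite -EFinD !gE; congr EFin.
      rewrite -[X in _ = X + _]mul1r -gexp_lin; congr gexp; apply/funext => k.
      rewrite mul1r !indicE in_setU; case kU : (k \in U n); case kF : (k \in F n); rewrite /= ?addr0 ?add0r //.
      have Uk : U n k by move/set_mem: kU.
      have Fk : F n k by move/set_mem: kF.
      have : (U n `&` F n : set (Omega d)) k by split.
      by rewrite dj.
    rewrite ge0_integralD //.
    + by move=> l _; rewrite lee_fin; case/andP: (gU (U n) l).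
    + by apply: measurable_EFinh; exact: gM.
    + by move=> l _; rewrite lee_fin; case/andP: (gU (F n) l).
    + by apply: measurable_EFinh; exact: gM.
  have mUF : measurable (\bigcup_k F k) by exact: bigcupT_measurable.
  have c1 : I (fun l => gammaA p q E (U n) l) @[n --> \oo] --> I (fun l => gammaA p q E (\bigcup_k F k) l).
    apply: integral_bounded_cvg => [n||n|l]; [exact: gM|exact: gM|exact: gU|].
    rewrite gE; have h : gexp rho es l (\1_(U n)) @[n --> \oo] --> gexp rho es l (\1_(\bigcup_k F k)).
      apply: (@gexp_cvg _ _ (fun=> rho)) => // [e k _|k _]; first exact: cvg_cst.
      apply: cvg_near_cst; have [[i _ Fik]|nF] := pselect ((\bigcup_k F k) k).
        exists i.+1 => // n /= ni; rewrite !indicE !mem_set ?eqxx //; first by exists i.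
        rewrite /U -bigcup_mkord; exists i => //.
      apply: nearW => n; rewrite !indicE !memNset ?eqxx //.
      by rewrite /U -bigcup_mkord => -[i _ Fik]; apply: nF; exists i.
    by apply: eq_near_cvg h; apply: nearW => n; rewrite gE.
  have c2 : gibbs_mu (U n) @[n --> \oo] --> gibbs_mu (\bigcup_k F k).
    have e : \bigcup_k F k = \bigcup_n U n.
      apply/seteqP; split => x [i _ Fx].
        by exists i.+1 => //; rewrite /U -bigcup_mkord; exists i => /=.
      by move: Fx; rewrite /U -bigcup_mkord => -[j _ Fx]; exists j.
    rewrite e; apply: nondecreasing_cvg_mu => //; first by rewrite -e.
    by move=> n m nm; apply/subsetPset; apply: subset_bigsetU.
  rewrite (_ : (fun n => I (fun l => gammaA p q E (U n) l)) = (fun n => gibbs_mu (U n))) in c1.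
    exact: (cvg_unique _ c1 c2).
  by apply/funext.
Qed.

Lemma unique_gibbs_small : unique_gibbs d p q.
Proof.
exists gibbs_mu; split; first exact: gibbs_gibbs_mu.
move=> mu gmu; apply: eq_probability => B.
by rewrite gibbs_high // (gibbs_high _ gibbs_gibbs_mu).
Qed.

End GibbsMeasure.

(** * Degenerate parameters and conclusion *)

Section Degenerate.
Variables (d : nat) (R : realType) (p q : R) (b : bool).
Hypotheses (q1 : 1 <= q) (pb : p = b%:R).
Implicit Types (N : nat) (e : edge d) (k l : cfg d).

Local Notation c := ((fun=> b) : cfg d).

Lemma weight_degenerate N k : weight p q N k =
  (all (fun e => k e == b) (edges d N))%:R * (Num.sqrt (detLap q k N))^-1.
Proof.
rewrite weightE pb; congr (_ * _); elim: (edges d N) => [|e es IH]; first by rewrite big_nil.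
rewrite big_cons IH /=; case: b; case: (k e); rewrite /= ?mul1r ?mul0r ?subrr ?subr0 ?mul1r ?mul0r //.
Qed.

(** If [l] deviates from [b] off [E], all weights vanish once the box contains such an edge, and the
    quotient [0 / 0] is 0: the kernel at [l] is the zero measure. *)
Lemma gammaN_degenerate (E : {fset edge d}) l (t : {ffun E -> bool}) :
  \forall N \near \oo, gammaN p q N E (upd l t) l =
    (`[< agree (enum_fset E) c l >] && (t == [ffun=> b]))%:R.
Proof.
case: asboolP => [al|nal] /=; last first.
  have [e eE le] : exists2 e, e \notin enum_fset E & l e != b.
    apply: contrapT => h; apply: nal => e eE; apply/eqP; apply: contrapT => le.
    by apply: h; exists e => //; apply/negP.
  have [N0 eN0] := in_box_exists e; exists N0 => // N /= NN0.
  rewrite /gammaN weight_degenerate.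
  have -> : all (fun f => upd l t f == b) (edges d N) = false.
    apply/negbTE/allPn; exists e; first by rewrite mem_edges; exact: in_edges_le eN0.
    by rewrite /upd insubN.
  by rewrite mul0r mulr0 mul0r.
have allE (t' : {ffun E -> bool}) N : {subset enum_fset E <= edges d N} ->
    all (fun f => upd l t' f == b) (edges d N) = (t' == [ffun=> b]).
  move=> EN; apply/allP/eqP => [h|-> e _].
    apply/ffunP => e; rewrite ffunE; have := h _ (EN _ (fsvalP e)).
    by rewrite /upd valK => /eqP.
  by rewrite /upd; case: insubP => [e' _ _|eE]; rewrite ?ffunE // al.
apply: filterS (subset_edges (enum_fset E)) => N EN.
rewrite /gammaN asboolT; last exact: upd_agree.
have S0 k : (Num.sqrt (detLap q k N))^-1 != 0.
  by rewrite invr_neq0 // gt_eqF // sqrtr_gt0; exact: detLap_gt0.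
rewrite mul1r (bigD1 [ffun=> b]) //= big1 ?addr0 => [|t' /negbTE t't]; last first.
  by rewrite weight_degenerate allE // t't mul0r.
rewrite !weight_degenerate !allE // eqxx mul1r; case: eqP => [->|_]; last by rewrite !mul0r.
by rewrite mul1r divff.
Qed.

Lemma gammaN_degenerate_cvg (E : {fset edge d}) l (t : {ffun E -> bool}) :
  gammaN p q N E (upd l t) l @[N --> \oo] -->
    ((`[< agree (enum_fset E) c l >] && (t == [ffun=> b]))%:R : R).
Proof. exact: cvg_near_cst (gammaN_degenerate l t). Qed.

Lemma gamma_degenerate (E : {fset edge d}) l (t : {ffun E -> bool}) :
  gamma p q E (upd l t) l = (`[< agree (enum_fset E) c l >] && (t == [ffun=> b]))%:R.
Proof. by apply: (@cvg_lim R) => //; exact: gammaN_degenerate_cvg. Qed.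

Lemma gammaA_degenerate (E : {fset edge d}) (A : set (cfg d)) l :
  gammaA p q E A l = (`[< agree (enum_fset E) c l >])%:R * \1_A c.
Proof.
rewrite /gammaA; case: (asboolP (agree (enum_fset E) c l)) => [al|nal]; last first.
  rewrite mul0r big1 // => t _; rewrite gamma_degenerate.
  by rewrite (asboolF nal) /= mulr0.
rewrite (bigD1 [ffun=> b]) //= big1 ?addr0 => [|t /negbTE tb]; last first.
  by rewrite gamma_degenerate tb andbF mulr0.
rewrite gamma_degenerate (asboolT al) eqxx mulr1 mul1r.
have -> : upd l [ffun _ : E => b] = c.
  by apply/funext => e; rewrite /upd; case: insubP => [e' _ _|eE]; rewrite ?ffunE // al.
by rewrite indicE; case: asboolP => h; [rewrite mem_set|rewrite memNset].
Qed.

(** As the kernel has no mass at other boundary conditions, the Gibbs equation for the empty edge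
    set and the full event forces a Gibbs measure to live on the constant configuration. *)
Lemma unique_gibbs_degenerate : unique_gibbs d p q.
Proof.
have mg (E : {fset edge d}) (A : set (Omega d)) : measurable A ->
    measurable_fun [set: Omega d] (fun l : Omega d => gammaA p q E A l).
  move=> mA; apply: measurable_gammaA => // E' l t.
  by rewrite gamma_degenerate; exact: gammaN_degenerate_cvg.
pose mu : probability (Omega d) R := dirac (c : Omega d).
exists mu; split.
  move=> E A mA; rewrite integral_dirac //; last by apply: measurable_EFinh; exact: mg.
  by rewrite diracT mul1e gammaA_degenerate asboolT // mul1r.
move=> nu gnu A mA.
have h A' : measurable A' -> nu A' = (\1_A' c)%:E.
  have one : (\int[nu]_l (`[< agree (enum_fset fset0) c l >])%:R%:E = 1 :> \bar R)%E.
    have := gnu fset0 setT measurableT; rewrite [X in _ = X -> _](@probability_setT _ _ _ nu) => <-.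
    by apply: eq_integral => l _; rewrite gammaA_degenerate indicT mulr1.
  move=> mA'; have := gnu fset0 A' mA' => <-; rewrite indicE; case E : (_ \in A').
    rewrite -[RHS]one; apply: eq_integral => l _.
    by rewrite gammaA_degenerate indicE E mulr1.
  rewrite -[RHS](@integral0 _ _ _ nu setT); apply: eq_integral => l _.
  by rewrite gammaA_degenerate indicE E mulr0.
by rewrite h.
Qed.

End Degenerate.

Lemma unique_gibbs_all (d : nat) (R : realType) (p q : R) : (0 < d)%N -> 0 <= p <= 1 -> 1 <= q ->
  p * (1 - p) * (q - 1) ^+ 2 * q ^+ 2 <= 1 -> unique_gibbs d p q.
Proof.
move=> d0 /andP[p0 p1] q1 small.
have [->|pn0] := eqVneq p 0; first exact: (@unique_gibbs_degenerate _ _ _ _ false).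
have [->|pn1] := eqVneq p 1; first exact: (@unique_gibbs_degenerate _ _ _ _ true).
by apply: unique_gibbs_small => //; rewrite !lt_def p0 p1 pn0 eq_sym pn1.
Qed.

Theorem theorem5p4 (R : realType) (d : nat) : (4 <= d)%N ->
  (exists q0 : R, 1 < q0 /\
     forall p q : R, 0 <= p <= 1 -> 1 <= q < q0 -> unique_gibbs d p q) /\
  (forall q : R, 1 <= q ->
     exists p0 : R, 0 < p0 /\
       forall p : R, 0 <= p <= 1 -> (p < p0 \/ 1 - p0 < p) -> unique_gibbs d p q).
Proof.
move=> d4; have d0 : (0 < d)%N by apply: leq_trans d4.
split.
  (* [p * (1 - p)] is at most 1/4 and [(q - 1) * q] equals 2 at [q = 2], so the product in the
     smallness condition stays below 1/4 times 4. *)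
  exists 2; split; first by lra.
  move=> p q p01 /andP[q1 q2]; apply: unique_gibbs_all => //.
  have a : 0 <= p * (1 - p) <= 1 / 4.
    case/andP: p01 => p0 p1; apply/andP; split; first by apply: mulr_ge0; lra.
    by have := sqr_ge0 (p - 1 / 2); rewrite expr2; lra.
  have b : 0 <= (q - 1) * q <= 2.
    have h := mulr_ge0 (_ : 0 <= q - 1) (_ : 0 <= q); apply/andP; split; first by apply: h; lra.
    by rewrite -[X in _ <= X]mul1r ler_pM //; lra.
  rewrite -mulrA -exprMn; move: (p * (1 - p)) ((q - 1) * q) a b => x y /andP[x0 x1] /andP[y0 y2].
  have : y ^+ 2 <= 4 by rewrite expr2; nra.
  move=> y4; have := ler_pM x0 (sqr_ge0 y) x1 y4; lra.
move=> q q1; pose X := (q - 1) ^+ 2 * q ^+ 2.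
have X0 : 0 <= X by rewrite mulr_ge0 // sqr_ge0.
have X1 : 0 < 1 + X by lra.
(* Adding 1 keeps the inverse positive at [q = 1], where [X] is 0. *)
exists (1 + X)^-1; split; first by rewrite invr_gt0.
move=> p /andP[p0 p1] hp; apply: unique_gibbs_all => //; first by rewrite p0.
rewrite -mulrA -/X.
have small t : 0 <= t -> t < (1 + X)^-1 -> t * X <= 1.
  by move=> t0 tX; have := tX; rewrite -div1r ltr_pdivlMr // mulrDr mulr1; lra.
case: hp => hp.
  have := small p p0 hp; have : p * (1 - p) * X <= p * X.
    by rewrite ler_wpM2r // ler_piMr //; lra.
  lra.
have := small (1 - p); have : p * (1 - p) * X <= (1 - p) * X.
  by rewrite ler_wpM2r // ler_piMl //; lra.
move=> h1 h2; apply: le_trans h1 _; apply: h2; lra.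
Qed.
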